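(* Consider the high-dimensional linear regression model described in the context. Let $0<\gamma<1$, and let $\widehat{\boldsymbol{\beta}}_n=(\widehat{\boldsymbol{\beta}}_{1n}',\widehat{\boldsymbol{\beta}}_{2n}')'$ (with $\widehat{\boldsymbol{\beta}}_{1n}\in\mathbb{R}^{k_n}$, $\widehat{\boldsymbol{\beta}}_{2n}\in\mathbb{R}^{m_n}$ the estimators of $\boldsymbol{\beta}_{10}$, $\boldsymbol{\beta}_{20}$) be the minimizer over $\boldsymbol{\beta}\in\mathbb{R}^{p_n}$ of $$L_n(\boldsymbol{\beta})=\sum_{i=1}^n (Y_i-\mathbf{x}_i'\boldsymbol{\beta})^2+\lambda_n\sum_{j=1}^{p_n}|\beta_j|^\gamma .$$ Suppose that: 1. $\varepsilon_1,\varepsilon_2,\ldots$ are independent and identically distributed random variables with mean zero and variance $\sigma^2$, where $0<\sigma^2<\infty$; 2. $\rho_{1n}>0$ for all $n$, and $(p_n+\lambda_n k_n)(n\rho_{1n})^{-1}\to 0$; 3. $\lambda_n (k_n/n)^{1/2}\to 0$ and $\lambda_n n^{-\gamma/2}(\rho_{1n}/\sqrt{p_n})^{2-\gamma}\to\infty$; 4. there exist constants $0<b_0<b_1<\infty$ (not depending on $n$) such that $b_0\le \min_{1\le j\le k_n}|\beta_{10,j}|\le \max_{1\le j\le k_n}|\beta_{10,j}|\le b_1$, where $\beta_{10,j}$ is the $j$th component of $\boldsymbol{\beta}_{10}$; 5. there exist constants $0<\tau_1<\tau_2<\infty$ such that $\tau_1\le\tau_{1n}\le\tau_{2n}\le\tau_2$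 for all $n$, and $n^{-1/2}\max_{1\le i\le n}\mathbf{w}_i'\mathbf{w}_i\to 0$. Then, as $n\to\infty$: (i) $\widehat{\boldsymbol{\beta}}_{2n}=\mathbf{0}$ with probability converging to $1$. (ii) For any $k_n\times 1$ nonzero vectors $\boldsymbol{\alpha}_n$ satisfying $\|\boldsymbol{\alpha}_n\|\le 1$, with $s_n^2=\sigma^2\boldsymbol{\alpha}_n'\Sigma_{1n}^{-1}\boldsymbol{\alpha}_n$, $$n^{1/2}s_n^{-1}\boldsymbol{\alpha}_n'(\widehat{\boldsymbol{\beta}}_{1n}-\boldsymbol{\beta}_{10})=n^{-1/2}s_n^{-1}\sum_{i=1}^n\varepsilon_i\boldsymbol{\alpha}_n'\Sigma_{1n}^{-1}\mathbf{w}_i+o_p(1)\to_D N(0,1),$$ where $o_p(1)$ is a term that converges to zero in probability uniformly with respect to $\boldsymbol{\alpha}_n$.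
   Context: For each sample size $n$, the model is $Y_i=\mathbf{x}_i'\boldsymbol{\beta}_0+\varepsilon_i$, $i=1,\ldots,n$, where $\mathbf{x}_i=(x_{i1},\ldots,x_{ip_n})'\in\mathbb{R}^{p_n}$ are fixed (nonrandom) covariate vectors and $\boldsymbol{\beta}_0\in\mathbb{R}^{p_n}$ is the true parameter; $p_n$, $\mathbf{x}_i$ and $\boldsymbol{\beta}_0$ may depend on $n$. The covariates are standardized: $\sum_{i=1}^n x_{ij}=0$ and $n^{-1}\sum_{i=1}^n x_{ij}^2=1$ for $j=1,\ldots,p_n$. The true parameter is partitioned as $\boldsymbol{\beta}_0=(\boldsymbol{\beta}_{10}',\boldsymbol{\beta}_{20}')'$, where $\boldsymbol{\beta}_{10}$ is a $k_n\times 1$ vector (the nonzero coefficients) and $\boldsymbol{\beta}_{20}=\mathbf{0}$ is an $m_n\times 1$ vector, $p_n=k_n+m_n$. Correspondingly $\mathbf{x}_i=(\mathbf{w}_i',\mathbf{z}_i')'$ with $\mathbf{w}_i\in\mathbb{R}^{k_n}$, $\mathbf{z}_i\in\mathbb{R}^{m_n}$. $\lambda_n\ge 0$ is a deterministic penalty parameter. $\mathbf{X}_n$ and $\mathbf{X}_{1n}$ are the matrices with rows $\mathbf{x}_i'$ and $\mathbf{w}_i'$ ($i=1,\ldots,n$), respectively; $\Sigma_n=n^{-1}\mathbf{X}_n'\mathbf{X}_n$ and $\Sigma_{1n}=n^{-1}\mathbf{X}_{1n}'\mathbf{X}_{1n}$. $\rho_{1n}$ is the smallest eigenvalue of $\Sigma_n$;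 $\tau_{1n}$ and $\tau_{2n}$ are the smallest and largest eigenvalues of $\Sigma_{1n}$. $\|\cdot\|$ is the Euclidean norm, $\to_D$ denotes convergence in distribution, and all limits are as $n\to\infty$. *)

(* Defs.v *)
From HB Require Import structures.
From mathcomp Require Import all_boot all_order all_algebra.
From mathcomp Require Import all_classical all_reals all_analysis.

Set Implicit Arguments.
Unset Strict Implicit.
Unset Printing Implicit Defensive.

Import Order.TTheory GRing.Theory Num.Theory.
Import numFieldNormedType.Exports.

Local Open Scope classical_set_scope.
Local Open Scope ring_scope.

(* The library norm on matrices is the sup norm, hence this definition. *)
Definition l2norm (R : realType) (p : nat) (v : 'cV[R]_p) : R :=
  Num.sqrt (\sum_(j < p) v j 0 ^+ 2).

Definition gram (R : realType) (n p : nat) (X : 'M[R]_(n, p)) : 'M[R]_p :=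
  n%:R^-1 *: (X^T *m X).

(* A matrix has finitely many eigenvalues, so the infimum and supremum are
   attained as soon as there is one, which is the case for a symmetric matrix
   of positive size.  For a matrix of size 0 both are 0 by convention. *)
Definition min_eigenvalue (R : realType) (p : nat) (A : 'M[R]_p) : R :=
  inf [set a : R | eigenvalue A a].

Definition max_eigenvalue (R : realType) (p : nat) (A : 'M[R]_p) : R :=
  sup [set a : R | eigenvalue A a].

Definition standardized (R : realType) (n p : nat) (X : 'M[R]_(n, p)) : Prop :=
  forall j : 'I_p,
    \sum_(i < n) X i j = 0 /\ n%:R^-1 * \sum_(i < n) X i j ^+ 2 = 1.

(* The first n terms e 0, ..., e (n - 1) of the error sequence are used. *)
Definition response (R : realType) (n p : nat) (X : 'M[R]_(n, p))
    (beta0 : 'cV[R]_p) (e : nat -> R) (i : 'I_n) : R :=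
  (X *m beta0) i 0 + e i.

(* For gamma != 0 the library power satisfies 0 `^ gamma = 0. *)
Definition bridge_objective (R : realType) (n p : nat) (gamma lambda : R)
    (X : 'M[R]_(n, p)) (Y : 'I_n -> R) (b : 'cV[R]_p) : R :=
  \sum_(i < n) (Y i - (X *m b) i 0) ^+ 2
    + lambda * \sum_(j < p) `|b j 0| `^ gamma.

Definition asymptotic_sd (R : realType) (k : nat) (sigma : R)
    (Sigma1 : 'M[R]_k) (alpha : 'cV[R]_k) : R :=
  Num.sqrt (sigma ^+ 2 * (alpha^T *m invmx Sigma1 *m alpha) 0 0).

(* n^(1/2) s_n^-1 alpha' (b1 - beta10), where W has rows w_i'. *)
Definition scaled_error (R : realType) (n k : nat) (sigma : R)
    (W : 'M[R]_(n, k)) (alpha beta10 b1 : 'cV[R]_k) : R :=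
  Num.sqrt n%:R * (asymptotic_sd sigma (gram W) alpha)^-1
    * (alpha^T *m (b1 - beta10)) 0 0.

(* n^(-1/2) s_n^-1 sum_i e_i alpha' Sigma1^-1 w_i, where W has rows w_i'. *)
Definition linear_term (R : realType) (n k : nat) (sigma : R)
    (W : 'M[R]_(n, k)) (alpha : 'cV[R]_k) (e : nat -> R) : R :=
  (Num.sqrt n%:R)^-1 * (asymptotic_sd sigma (gram W) alpha)^-1
    * \sum_(i < n) e i * (alpha^T *m invmx (gram W) *m (row i W)^T) 0 0.

(* Mutual independence: the product rule over every finite set of indices. *)
Definition independent_RVs (d : measure_display) (T : measurableType d)
    (R : realType) (P : probability T R) (X : nat -> {RV P >-> R}) : Prop :=
  forall (J : seq nat) (A : nat -> set R),
    uniq J -> (forall j, measurable (A j)) ->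
    P (\bigcap_(j in [set` J]) (X j @^-1` A j))
      = (\prod_(j <- J) P (X j @^-1` A j))%E.

Definition identically_distributed (d : measure_display) (T : measurableType d)
    (R : realType) (P : probability T R) (X : nat -> {RV P >-> R}) : Prop :=
  forall (i j : nat) (A : set R),
    measurable A -> distribution P (X i) A = distribution P (X j) A.

(* Convergence of the distribution functions at every continuity point of the
   limit distribution function. *)
Definition cvg_in_distribution (d : measure_display) (T : measurableType d)
    (R : realType) (P : probability T R) (X : nat -> T -> R)
    (mu : probability (measurableTypeR R) R) : Prop :=
  forall t : R,
    {for t, continuous (fun u : R => mu [set` `]-oo, u]])} ->
    P [set w | X n w <= t] @[n --> \oo] --> mu [set` `]-oo, t]].

(* Main.v *)
Require Import Defs.
From HB Require Import structures.
From mathcomp Require Import all_boot all_order all_algebra.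
From mathcomp Require Import all_classical all_reals all_analysis.
From mathcomp Require Import measurable_realfun ring lra.

Set Implicit Arguments.
Unset Strict Implicit.
Unset Printing Implicit Defensive.

Import Order.TTheory GRing.Theory Num.Theory.
Import numFieldNormedType.Exports.

Local Open Scope classical_set_scope.
Local Open Scope ring_scope.

(** Write [p] for the number of covariates, [rho] for the smallest eigenvalue of
    the Gram matrix, [h] for the estimation error, [g] for the score [X^T *m e]
    of the noise, and [H = sqrt (p / n) / rho] for the target rate.

    The estimator is treated deterministically on the event that the squared norm
    of [g] is at most [M ^+ 2 * n * p].  Its complement has probability at most
    [sigma ^+ 2 / M ^+ 2] by Markov ([score_tail]), since the second moment of the
    norm of [g] is [sigma ^+ 2 * n * p].  On this event, for large [n], everything
    else follows ([eventually_oracle]).  Comparing the objective at the estimator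
    and at the true parameter gives consistency ([consistency_bound]).  Once the
    active coefficients are known to stay away from 0, the penalty is Lipschitz
    there; the comparison becomes linear in the norm of [h], and the rate [H]
    follows ([estimation_rate]).  Near 0 the slope of the penalty is infinite: if
    an inactive coefficient [b_j] were nonzero, setting it to 0 would show that
    [lambda] is at most a constant times [n * H `^ (2 - gamma)], against the lower
    bound on [lambda] ([inactive_coefficients_zero]).  Finally, perturbing one
    active coefficient bounds the score of the residual by a multiple of
    [lambda], so that the least squares equation holds up to a negligible
    remainder ([remainder_bound]).

    The remainder, normalized by the standard deviation, is a linear functional
    of [alpha] divided by the norm of [alpha] in the inverse Gram form.  By
    Cauchy-Schwarz its squared supremum over [alpha] is a quadratic form in the
    remainder vector ([exists_normalized_functional]); this gives uniformity in
    [alpha], and also the measurability of the event in the statement.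

    The normal limit of the linear term is Lindeberg's replacement argument.  The
    functions [Phi ((t - x) / sqrt v)] of [x], which are the indicator of [x <= t]
    smoothed by a normal law of variance [v], solve the heat equation in [v].  Hence a noise variable can be traded for an increase of [v] at the
    cost of a third order error ([lindeberg_step]), and no normal variable has to
    be constructed.  Summing the errors gives [smoothed_clt]; letting the initial
    variance tend to 0 and absorbing the remainder gives [clt_slutsky]. *)

(** * Quadratic forms and the smallest eigenvalue *)

Section QuadraticForms.
Context {R : realType}.

Definition bilin {p q : nat} (u : 'cV[R]_p) (A : 'M[R]_(p, q)) (v : 'cV[R]_q) : R :=
  (u^T *m A *m v) 0 0.

Definition dot {p : nat} (u v : 'cV[R]_p) : R := (u^T *m v) 0 0.

Lemma dotE p (u v : 'cV[R]_p) : dot u v = \sum_i u i 0 * v i 0.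
Proof. by rewrite /dot mxE; apply: eq_bigr => i _; rewrite mxE. Qed.

Lemma dotC p (u v : 'cV[R]_p) : dot u v = dot v u.
Proof. by rewrite !dotE; apply: eq_bigr => i _; rewrite mulrC. Qed.

Lemma bilin_dot p q (u : 'cV[R]_p) (A : 'M[R]_(p, q)) v :
  bilin u A v = dot u (A *m v).
Proof. by rewrite /bilin /dot mulmxA. Qed.

Lemma dotDl p (u v w : 'cV[R]_p) : dot (u + v) w = dot u w + dot v w.
Proof. by rewrite /dot linearD mulmxDl mxE. Qed.

Lemma dotDr p (u v w : 'cV[R]_p) : dot w (u + v) = dot w u + dot w v.
Proof. by rewrite /dot mulmxDr mxE. Qed.

Lemma dotZl p a (u w : 'cV[R]_p) : dot (a *: u) w = a * dot u w.
Proof. by rewrite /dot linearZ -scalemxAl mxE. Qed.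

Lemma dotZr p a (u w : 'cV[R]_p) : dot w (a *: u) = a * dot w u.
Proof. by rewrite /dot -scalemxAr mxE. Qed.

Lemma dot_trmx p q (A : 'M[R]_(p, q)) u v : dot (A^T *m u) v = dot u (A *m v).
Proof. by rewrite /dot trmx_mul trmxK mulmxA. Qed.

Lemma dot_ge0 p (u : 'cV[R]_p) : 0 <= dot u u.
Proof. by rewrite dotE sumr_ge0 // => i _; rewrite -expr2 sqr_ge0. Qed.

Lemma dot_eq0 p (u : 'cV[R]_p) : (dot u u == 0) = (u == 0).
Proof.
apply/idP/eqP => [|->]; last by rewrite /dot mulmx0 mxE.
rewrite dotE psumr_eq0; last by move=> i _; rewrite -expr2 sqr_ge0.
move=> /allP h; apply/colP => i; rewrite mxE.
by have := h i (mem_index_enum i); rewrite /= -expr2 sqrf_eq0 => /eqP.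
Qed.

Lemma dot_gt0 p (u : 'cV[R]_p) : (0 < dot u u) = (u != 0).
Proof. by rewrite lt_neqAle dot_ge0 andbT eq_sym dot_eq0. Qed.

Lemma entry_sqr_le_dot p (u : 'cV[R]_p) i : u i 0 ^+ 2 <= dot u u.
Proof.
rewrite dotE (bigD1 i) //= expr2 lerDl sumr_ge0 // => j _.
by rewrite -expr2 sqr_ge0.
Qed.

Lemma bilin_sym p (A : 'M[R]_p) u v : A^T = A -> bilin u A v = bilin v A u.
Proof. by move=> sA; rewrite !bilin_dot -dot_trmx sA dotC. Qed.

(** With [q] the quadratic form and [b] the value of the bilinear form at [u] and
    [v], the vector [q v *: u - b *: v] is the one that makes the discriminant
    argument work without dividing by [q v]; when [q v = 0] the value of the form
    at a suitable combination forces [b = 0]. *)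
Lemma psd_cauchy_schwarz p (A : 'M[R]_p) :
  A^T = A -> (forall v, 0 <= bilin v A v) ->
  forall u v, bilin u A v ^+ 2 <= bilin u A u * bilin v A v.
Proof.
move=> sA psd u v.
have quad a b : 0 <= a ^+ 2 * bilin u A u + 2 * a * b * bilin u A v
                   + b ^+ 2 * bilin v A v.
  have := psd (a *: u + b *: v).
  have -> : bilin (a *: u + b *: v) A (a *: u + b *: v)
     = a ^+ 2 * bilin u A u + a * b * bilin u A v + a * b * bilin v A u
         + b ^+ 2 * bilin v A v.
    rewrite !bilin_dot mulmxDr -!scalemxAr !(dotDl, dotDr, dotZl, dotZr); ring.
  rewrite (bilin_sym v u sA); lra.
have [q0|q0] := eqVneq (bilin v A v) 0; last first.
  have qp : 0 < bilin v A v by rewrite lt_neqAle eq_sym q0 psd.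
  have := quad (bilin v A v) (- bilin u A v).
  rewrite -(pmulr_rge0 _ qp) => h.
  have : 0 <= bilin v A v * (bilin u A u * bilin v A v - bilin u A v ^+ 2).
    have := quad (bilin v A v) (- bilin u A v); nra.
  by rewrite pmulr_rge0 // subr_ge0.
rewrite q0 mulr0.
have := quad (bilin u A v) (- (1 + bilin u A u)); rewrite q0.
have := psd u.
set a := bilin u A u; set b := bilin u A v => a0 h.
nra.
Qed.

Lemma cauchy_schwarz_dot p (u v : 'cV[R]_p) : dot u v ^+ 2 <= dot u u * dot v v.
Proof.
have := @psd_cauchy_schwarz p 1%:M (trmx1 _ _).
rewrite /bilin => /(_ _ u v); rewrite !mulmx1; apply.
by move=> w; rewrite mulmx1 -/(dot w w) dot_ge0.
Qed.

Lemma dot_ler p (u v : 'cV[R]_p) :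
  `|dot u v| <= Num.sqrt (dot u u) * Num.sqrt (dot v v).
Proof.
rewrite -sqrtrM ?dot_ge0 // -sqrtr_sqr ler_wsqrtr //; exact: cauchy_schwarz_dot.
Qed.

Lemma bilin_bound p (A : 'M[R]_p) :
  exists2 C, 0 < C & forall v, `|bilin v A v| <= C * dot v v.
Proof.
exists (1 + \sum_i \sum_j `|A i j|).
  by rewrite ltr_pwDl // sumr_ge0 // => i _; rewrite sumr_ge0.
move=> v.
have le_entry i j : `|v i 0 * v j 0| <= dot v v.
  have hi := entry_sqr_le_dot v i; have hj := entry_sqr_le_dot v j.
  rewrite ler_norml; apply/andP; split; nra.
have -> : bilin v A v = \sum_i \sum_j A i j * (v i 0 * v j 0).
  rewrite bilin_dot dotE; apply: eq_bigr => i _; rewrite mxE mulr_sumr.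
  by apply: eq_bigr => j _; rewrite mulrCA.
rewrite (le_trans (ler_norm_sum _ _ _)) // mulrDl mul1r.
apply: ler_wpDl; first exact: dot_ge0.
rewrite mulr_suml; apply: ler_sum => i _.
rewrite (le_trans (ler_norm_sum _ _ _)) // mulr_suml; apply: ler_sum => j _.
by rewrite normrM ler_wpM2l.
Qed.

(** The infimum [mu] of the Rayleigh quotient is an eigenvalue: otherwise
    [A - mu] is an invertible positive semidefinite form, and Cauchy-Schwarz
    for this form bounds it below by a positive multiple of the squared norm,
    so that [mu] could be increased. *)
Lemma min_eigenvalue_le_rayleigh p (A : 'M[R]_p) : A^T = A ->
  forall v, min_eigenvalue A * dot v v <= bilin v A v.
Proof.
move=> sA v.
have [->|v0] := eqVneq v 0.
  by rewrite /bilin /dot !mulmx0 !mxE mulr0.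
have [C C0 hC] := bilin_bound A.
have normalize (w : 'cV[R]_p) : w != 0 -> exists2 c, 0 < c & dot (c *: w) (c *: w) = 1.
  rewrite -dot_gt0 => w0; exists (Num.sqrt (dot w w))^-1.
    by rewrite invr_gt0 sqrtr_gt0.
  rewrite dotZl dotZr mulrA -expr2 exprVn sqr_sqrtr ?ltW // mulVf // gt_eqF //.
pose S := [set r : R | exists2 w : 'cV[R]_p, dot w w = 1 & r = bilin w A w].
have S0 : S !=set0.
  by have [c _ hc] := normalize _ v0; exists (bilin (c *: v) A (c *: v)), (c *: v).
have lbS : lbound S (- C).
  move=> _ [w w1 ->]; have := hC w; rewrite w1 mulr1 ler_norml => /andP[] //.
have infS : has_inf S by split => //; exists (- C).
set mu := inf S.
have ray w : mu * dot w w <= bilin w A w.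
  have [->|w0] := eqVneq w 0; first by rewrite /bilin /dot !mulmx0 !mxE mulr0.
  have [c c0 hc] := normalize _ w0.
  have : mu <= bilin (c *: w) A (c *: w) by apply: ge_inf; [exists (- C)|exists (c *: w)].
  move: hc; rewrite !bilin_dot -scalemxAr !dotZl !dotZr => hc h.
  have : 0 <= c * c * (dot w (A *m w) - mu * dot w w).
    have -> : c * c * (dot w (A *m w) - mu * dot w w)
        = c * (c * dot w (A *m w)) - mu * (c * (c * dot w w)) by ring.
    by rewrite hc mulr1 subr_ge0.
  by rewrite pmulr_rge0 ?mulr_gt0 // subr_ge0.
have eig_mu : eigenvalue A mu.
  rewrite /eigenvalue /eigenspace kermx_eq0 row_free_unit; apply/negP => uB.
  set B := A - mu%:M in uB.
  have sB : B^T = B by rewrite /B linearB /= sA tr_scalar_mx.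
  have qB w z : bilin w B z = bilin w A z - mu * dot w z.
    rewrite !bilin_dot mulmxBl mul_scalar_mx dotDr -scaleN1r !dotZr; ring.
  have psd w : 0 <= bilin w B w by rewrite qB subr_ge0 ray.
  have [D D0 hD] := bilin_bound (invmx B).
  have low w : dot w w = 1 -> mu + D^-1 <= bilin w A w.
    move=> w1.
    have := psd_cauchy_schwarz sB psd w (invmx B *m w).
    have -> : bilin w B (invmx B *m w) = 1 by rewrite bilin_dot mulKVmx.
    have -> : bilin (invmx B *m w) B (invmx B *m w) = bilin w (invmx B) w.
      by rewrite !bilin_dot mulKVmx // dotC.
    rewrite qB w1 mulr1 expr1n => h.
    have h1 : bilin w (invmx B) w <= D.
      by have := hD w; rewrite w1 mulr1; apply: le_trans; rewrite ler_norm.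
    have h2 : 0 <= bilin w A w - mu by have := psd w; rewrite qB w1 mulr1.
    rewrite -lerBrDl -[leLHS]mul1r ler_pdivrMr //; nra.
  have : mu + D^-1 <= mu.
    by rewrite {2}/mu; apply: lb_le_inf => // _ [w w1 ->]; exact: low.
  by rewrite gerDl leNgt invr_gt0 D0.
apply: le_trans (ray v); apply: ler_wpM2r; first exact: dot_ge0.
apply: ge_inf => //; exists mu => a /eigenvalueP [r hr r0].
have rT0 : r^T != 0 by rewrite -(inj_eq (@trmx_inj _ _ _)) trmxK trmx0.
have := ray r^T; have -> : bilin r^T A r^T = a * dot r^T r^T.
  by rewrite /bilin trmxK hr -scalemxAl mxE /dot trmxK.
by rewrite ler_pM2r // dot_gt0.
Qed.

End QuadraticForms.

(** * Perturbations of a minimizer of the bridge objective *)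

Section Bridge.
Context {R : realType}.
Implicit Types (gamma lambda c x y : R).

(** For [x <= y] the bound follows from [(y / x) `^ gamma <= y / x]. *)
Lemma powR_lipschitz gamma c x y : 0 < gamma <= 1 -> 0 < c -> c <= x -> c <= y ->
  `|x `^ gamma - y `^ gamma| <= c `^ (gamma - 1) * `|x - y|.
Proof.
move=> /andP[g0 g1] c0.
wlog xy : x y / x <= y => [h cx cy|cx cy].
  have [/h|/ltW/h] := leP x y; first exact.
  by rewrite distrC (distrC x); exact.
have x0 : 0 < x := lt_le_trans c0 cx.
have y0 : 0 < y := lt_le_trans c0 cy.
rewrite distrC (distrC x) !ger0_norm ?subr_ge0 ?ge0_ler_powR //
  ?nnegrE ?(ltW x0, ltW y0, ltW g0) //.
have hx : x `^ gamma = x * x `^ (gamma - 1).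
  rewrite -{2}[x]powRr1 ?(ltW x0, ltW y0) // -powRD; first by congr (_ `^ _); ring.
  by rewrite (gt_eqF x0) implybT.
have hy : y `^ gamma <= y * x `^ (gamma - 1).
  rewrite -{1}[y](@divfK _ x) ?gt_eqF // powRM ?divr_ge0 ?(ltW x0, ltW y0) // hx mulrA.
  rewrite ler_wpM2r ?powR_ge0 // -[leRHS](@divfK _ x) ?gt_eqF // ler_wpM2r ?(ltW x0, ltW y0) //.
  rewrite -[leRHS]powRr1 ?divr_ge0 ?(ltW x0, ltW y0) // ler_powR //.
  by rewrite ler_pdivlMr // mul1r.
have hc : x `^ (gamma - 1) <= c `^ (gamma - 1).
  rewrite -(opprK (gamma - 1)) !(powRN _ (- (gamma - 1))).
  rewrite lef_pV2 ?posrE ?powR_gt0 // ge0_ler_powR ?nnegrE ?(ltW x0, ltW y0) //; lra.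
apply: (@le_trans _ _ (x `^ (gamma - 1) * (y - x))); first by rewrite hx; lra.
by rewrite ler_wpM2r // subr_ge0.
Qed.

Definition residual {n p : nat} (X : 'M[R]_(n, p)) (Y : 'I_n -> R) (b : 'cV[R]_p) :
    'cV[R]_n := \col_i (Y i - (X *m b) i 0).

Lemma bridge_objectiveE n p gamma lambda (X : 'M[R]_(n, p)) Y b :
  bridge_objective gamma lambda X Y b
  = dot (residual X Y b) (residual X Y b) + lambda * \sum_j `|b j 0| `^ gamma.
Proof.
rewrite /bridge_objective dotE; congr (_ + _); apply: eq_bigr => i _.
by rewrite expr2 !mxE.
Qed.

Definition is_minimizer n p gamma lambda (X : 'M[R]_(n, p)) Y (b : 'cV[R]_p) :=
  forall b', bridge_objective gamma lambda X Y b
             <= bridge_objective gamma lambda X Y b'.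

(** To be used with [s = - b j 0] for an inactive coefficient, and with [s] tending
    to 0 for an active one. *)
Lemma coordinate_perturbation n p gamma lambda (X : 'M[R]_(n, p)) Y b j s :
  is_minimizer gamma lambda X Y b ->
  0 <= - 2 * s * (X^T *m residual X Y b) j 0 + s ^+ 2 * \sum_i X i j ^+ 2
       + lambda * (`|b j 0 + s| `^ gamma - `|b j 0| `^ gamma).
Proof.
move=> /(_ (b + s *: delta_mx j 0)); rewrite !bridge_objectiveE.
have -> : residual X Y (b + s *: delta_mx j 0) = residual X Y b - s *: col j X.
  by apply/colP => i; rewrite /residual mulmxDr -scalemxAr -colE !mxE; ring.
have dcol : dot (col j X) (residual X Y b) = (X^T *m residual X Y b) j 0.
  by rewrite dotE mxE; apply: eq_bigr => i _; rewrite !mxE.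
have dcc : dot (col j X) (col j X) = \sum_i X i j ^+ 2.
  by rewrite dotE; apply: eq_bigr => i _; rewrite mxE expr2.
have pen : \sum_i `|(b + s *: delta_mx j 0) i 0| `^ gamma
    = \sum_i `|b i 0| `^ gamma + (`|b j 0 + s| `^ gamma - `|b j 0| `^ gamma).
  rewrite (bigD1 j) //= [\sum_i `|b i 0| `^ gamma](bigD1 j) //= !mxE !eqxx mulr1.
  rewrite (eq_bigr (fun i => `|b i 0| `^ gamma)); first by ring.
  by move=> i /negPf ij; rewrite !mxE ij mulr0 addr0.
rewrite pen -scaleNr !(dotDl, dotDr, dotZl, dotZr) (dotC _ (col j X)) dcol dcc.
lra.
Qed.

(** Setting the coefficient to 0 must not decrease the objective; the penalty that
    it would save is large for a small coefficient because [gamma < 1]. *)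
Lemma nonzero_coordinate n p gamma lambda (X : 'M[R]_(n, p)) Y b j :
  0 < gamma -> is_minimizer gamma lambda X Y b -> b j 0 != 0 ->
  lambda <= `|b j 0| `^ (1 - gamma) *
    (2 * `|(X^T *m residual X Y b) j 0| + `|b j 0| * \sum_i X i j ^+ 2).
Proof.
move=> g0 bmin bj0; have nb : 0 < `|b j 0| by rewrite normr_gt0.
have := coordinate_perturbation j (- b j 0) bmin.
rewrite subrr normr0 powR0 ?gt_eqF // sub0r mulrN.
set g := (X^T *m _) j 0; set q := \sum_i _ => h.
have h1 : lambda * `|b j 0| `^ gamma <= `|b j 0| * (2 * `|g| + `|b j 0| * q).
  have : b j 0 * g <= `|b j 0| * `|g| by rewrite -normrM ler_norm.
  have -> : `|b j 0| * (2 * `|g| + `|b j 0| * q)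
      = 2 * (`|b j 0| * `|g|) + b j 0 ^+ 2 * q.
    by rewrite -(real_normK (num_real (b j 0))); ring.
  move: h; lra.
rewrite -(ler_pM2r (powR_gt0 gamma nb)) mulrAC -powRD ?(gt_eqF nb) ?implybT //.
by rewrite subrK powRr1 // ltW.
Qed.

(** Letting the size of the perturbation tend to 0 gives the first order
    condition, with the Lipschitz constant of the penalty away from 0 instead of
    its derivative. *)
Lemma score_bound n p gamma lambda (X : 'M[R]_(n, p)) Y b j c :
  0 < gamma <= 1 -> 0 <= lambda -> is_minimizer gamma lambda X Y b ->
  0 < c -> 2 * c <= `|b j 0| ->
  2 * `|(X^T *m residual X Y b) j 0| <= lambda * c `^ (gamma - 1).
Proof.
move=> hg l0 bmin c0 cb.
set g := (X^T *m _) j 0; set q := \sum_i X i j ^+ 2.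
have q0 : 0 <= q by rewrite /q sumr_ge0 // => i _; rewrite sqr_ge0.
have small s : `|s| <= c -> 2 * s * g <= s ^+ 2 * q + lambda * c `^ (gamma - 1) * `|s|.
  move=> sc; have := coordinate_perturbation j s bmin; rewrite -/g -/q.
  have bs : c <= `|b j 0 + s|.
    have := ler_normB (b j 0 + s) s; rewrite addrK; lra.
  have cb' : c <= `|b j 0| by lra.
  have := powR_lipschitz hg c0 bs cb'.
  have : `| `|b j 0 + s| - `|b j 0| | <= `|s|.
    by rewrite (le_trans (ler_dist_dist _ _)) // addrAC subrr add0r.
  set L := c `^ _; have L0 : 0 <= L := powR_ge0 _ _.
  set u := _ `^ _; set v := _ `^ _ => h1 h2 h3.
  have : u - v <= L * `|s|.
    by rewrite (le_trans (ler_norm _)) // (le_trans h2) // ler_wpM2l.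
  move=> h4; have : lambda * (u - v) <= lambda * (L * `|s|) by rewrite ler_wpM2l.
  lra.
have pos s : 0 < s -> s <= c -> 2 * `|g| <= s * q + lambda * c `^ (gamma - 1).
  move=> s0 sc; rewrite -(ler_pM2l s0).
  have [gp|gn] := leP 0 g.
    have := small s; rewrite (gtr0_norm s0) (ger0_norm gp) => /(_ sc); lra.
  have := small (- s); rewrite normrN (gtr0_norm s0) (ltr0_norm gn) => /(_ sc); lra.
apply/ler_addgt0Pr => e e0.
pose s := Num.min c (e / (1 + q)).
have s0 : 0 < s by rewrite lt_min c0 divr_gt0 //; lra.
have := pos s s0; rewrite ge_min lexx => /(_ isT) /le_trans; apply.
rewrite addrC lerD2l (@le_trans _ _ (s * (1 + q))) //.
  by rewrite ler_wpM2l ?ltW //; lra.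
rewrite -ler_pdivlMr; last by lra.
by rewrite ge_min lexx orbT.
Qed.

Lemma residual_response n p (X : 'M[R]_(n, p)) b0 (e : nat -> R) b :
  residual X (response X b0 e) b = \col_i e i - X *m (b - b0).
Proof. by apply/colP => i; rewrite mulmxBr !mxE /response; rewrite !mxE; ring. Qed.

(** Minimality against the true parameter, after expanding both residuals around
    the noise. *)
Lemma basic_inequality n p gamma lambda (X : 'M[R]_(n, p)) b0 (e : nat -> R) b :
  is_minimizer gamma lambda X (response X b0 e) b ->
  dot (X *m (b - b0)) (X *m (b - b0))
  <= 2 * dot (X^T *m \col_i e i) (b - b0)
     + lambda * (\sum_j `|b0 j 0| `^ gamma - \sum_j `|b j 0| `^ gamma).
Proof.
move=> /(_ b0); rewrite !bridge_objectiveE.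
rewrite !residual_response subrr mulmx0 subr0.
set E := \col_i e i; set h := X *m (b - b0).
rewrite dot_trmx -/h -scaleN1r !(dotDl, dotDr, dotZl, dotZr) (dotC h E).
lra.
Qed.

End Bridge.

(** * Gram matrices *)

Section Gram.
Context {R : realType}.

Lemma gram_sym n p (X : 'M[R]_(n, p)) : (gram X)^T = gram X.
Proof. by rewrite /gram linearZ /= trmx_mul trmxK. Qed.

Lemma bilin_gram n p (X : 'M[R]_(n, p)) u v :
  bilin u (gram X) v = n%:R^-1 * dot (X *m u) (X *m v).
Proof.
by rewrite bilin_dot /gram -scalemxAl dotZr -mulmxA -dot_trmx trmxK.
Qed.

Lemma min_eigenvalue_gram n p (X : 'M[R]_(n, p)) u : (0 < n)%N ->
  n%:R * min_eigenvalue (gram X) * dot u u <= dot (X *m u) (X *m u).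
Proof.
move=> n0; have N0 : (0 : R) < n%:R by rewrite ltr0n.
have := min_eigenvalue_le_rayleigh (gram_sym X) u; rewrite bilin_gram.
by rewrite -mulrA -(ler_pM2l N0) mulVKf // gt_eqF.
Qed.

(** The columns have norm [sqrt n], so a basis vector has Rayleigh quotient 1. *)
Lemma min_eigenvalue_le1 n p (X : 'M[R]_(n, p)) : (0 < p)%N ->
  standardized X -> min_eigenvalue (gram X) <= 1.
Proof.
case: p X => // p X _ sX.
have := min_eigenvalue_le_rayleigh (gram_sym X) (delta_mx 0 0); rewrite bilin_gram.
have -> : dot (delta_mx 0 0 : 'cV[R]_p.+1) (delta_mx 0 0) = 1.
  by rewrite /dot trmx_delta mul_delta_mx mxE !eqxx.
rewrite mulr1 -colE dotE.
move/le_trans; apply; have [_ h] := sX 0; rewrite -[leRHS]h.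
rewrite le_eqVlt; apply/orP; left; apply/eqP; congr (_ * _).
by apply: eq_bigr => i _; rewrite mxE expr2.
Qed.

Section PositiveDefinite.
Variables (k : nat) (S : 'M[R]_k) (tau : R).
Hypotheses (symS : S^T = S) (tau0 : 0 < tau) (Stau : tau <= min_eigenvalue S).

Lemma pd_lower u : tau * dot u u <= bilin u S u.
Proof.
apply: le_trans (min_eigenvalue_le_rayleigh symS u).
by rewrite ler_wpM2r ?dot_ge0.
Qed.

Lemma pd_ge0 u : 0 <= bilin u S u.
Proof. by apply: le_trans (pd_lower u); rewrite mulr_ge0 ?dot_ge0 ?ltW. Qed.

Lemma pd_gt0 u : u != 0 -> 0 < bilin u S u.
Proof.
by move=> u0; apply: lt_le_trans (pd_lower u); rewrite mulr_gt0 ?dot_gt0.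
Qed.

Lemma pd_unit : S \in unitmx.
Proof.
rewrite -row_free_unit -kermx_eq0; apply/eqP/row_matrixP => i.
rewrite row0; apply/eqP; apply: contraT => r0.
have : 0 < bilin (row i (kermx S))^T S (row i (kermx S))^T.
  by apply: pd_gt0; rewrite -(inj_eq (@trmx_inj _ _ _)) trmxK trmx0.
by rewrite /bilin trmxK -row_mul mulmx_ker row0 mul0mx mxE ltxx.
Qed.

Lemma pd_inv u : bilin u (invmx S) u = bilin (invmx S *m u) S (invmx S *m u).
Proof. by rewrite !bilin_dot mulKVmx ?pd_unit // dotC. Qed.

(** Cauchy-Schwarz for the dot product between [u] and [invmx S *m u], combined
    with the lower bound at [invmx S *m u]; this avoids the spectrum of the
    inverse. *)
Lemma pd_inv_upper u : bilin u (invmx S) u <= tau^-1 * dot u u.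
Proof.
have h1 := pd_lower (invmx S *m u); rewrite -pd_inv in h1.
have h2 := cauchy_schwarz_dot u (invmx S *m u); rewrite -bilin_dot in h2.
have h3 : 0 <= bilin u (invmx S) u by rewrite pd_inv pd_ge0.
have d0 := dot_ge0 u.
rewrite mulrC ler_pdivlMr //.
have [q0|q0] := eqVneq (bilin u (invmx S) u) 0; first by rewrite q0 mul0r.
have qp : 0 < bilin u (invmx S) u by rewrite lt_neqAle eq_sym q0.
rewrite -(ler_pM2l qp); have := ler_wpM2l (ltW tau0) h2; have := ler_wpM2l d0 h1.
lra.
Qed.

(** Cauchy-Schwarz for the form [S] between [invmx S *m alpha] and [v], with
    equality for [alpha] proportional to [S *m v]. *)
Lemma exists_normalized_functional (sigma delta : R) (v : 'cV[R]_k) :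
  0 < sigma -> 0 < delta ->
  (exists alpha : 'cV[R]_k, [/\ alpha != 0, l2norm alpha <= 1 &
     delta < `|(asymptotic_sd sigma S alpha)^-1 * dot alpha v|])
  <-> (delta * sigma) ^+ 2 < bilin v S v.
Proof.
move=> s0 d0; have ds0 : 0 < delta * sigma by rewrite mulr_gt0.
have sdE al : asymptotic_sd sigma S al = sigma * Num.sqrt (bilin al (invmx S) al).
  by rewrite /asymptotic_sd sqrtrM ?sqr_ge0 // sqrtr_sqr gtr0_norm.
have i0 al : al != 0 -> 0 < bilin al (invmx S) al.
  move=> a0; rewrite pd_inv; apply: pd_gt0; apply: contra a0 => /eqP a0.
  by rewrite -[al](mulKVmx pd_unit) a0 mulmx0.
have dS al : dot al v = bilin (invmx S *m al) S v.
  by rewrite bilin_dot -dot_trmx symS mulKVmx // pd_unit.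
split=> [[al [a0 _]]|hv].
  rewrite sdE normrM normrV ?unitfE ?gt_eqF ?mulr_gt0 ?sqrtr_gt0 ?i0 //.
  rewrite ger0_norm ?mulr_ge0 ?sqrtr_ge0 ?(ltW s0) // mulrC.
  rewrite ltr_pdivlMr ?mulr_gt0 ?sqrtr_gt0 ?i0 // mulrA => h.
  have h2 : (delta * sigma * Num.sqrt (bilin al (invmx S) al)) ^+ 2 < dot al v ^+ 2.
    rewrite -(real_normK (num_real (dot al v))) ltrXn2r // ?nnegrE ?normr_ge0 //.
    by rewrite mulr_ge0 ?sqrtr_ge0 ?(ltW ds0).
  rewrite exprMn sqr_sqrtr ?(ltW (i0 _ a0)) // dS in h2.
  have := lt_le_trans h2 (psd_cauchy_schwarz symS pd_ge0 _ _).
  by rewrite -pd_inv [X in _ < X]mulrC ltr_pM2r ?i0.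
have v0 : v != 0.
  apply: contraTneq hv => ->; rewrite /bilin mulmx0 mxE -leNgt sqr_ge0 //.
have u0 : S *m v != 0.
  by apply: contra v0 => /eqP e; rewrite -[v](mulKmx pd_unit) e mulmx0.
have n0 : 0 < l2norm (S *m v).
  rewrite /l2norm sqrtr_gt0; move: u0; rewrite -dot_gt0 dotE.
  by under eq_bigr do rewrite -expr2.
set c := (l2norm (S *m v))^-1; have c0 : 0 < c by rewrite invr_gt0.
exists (c *: (S *m v)); split.
- by rewrite scaler_eq0 negb_or u0 gt_eqF.
- rewrite /l2norm; under eq_bigr do rewrite mxE exprMn.
  by rewrite -mulr_sumr sqrtrM ?sqr_ge0 // sqrtr_sqr gtr0_norm // mulVf // gt_eqF.
have -> : dot (c *: (S *m v)) v = c * bilin v S v by rewrite dotZl dotC -bilin_dot.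
rewrite sdE; have -> : bilin (c *: (S *m v)) (invmx S) (c *: (S *m v))
    = c ^+ 2 * bilin v S v.
  by rewrite !bilin_dot -scalemxAr mulKmx ?pd_unit // dotZl dotZr dotC mulrA.
rewrite sqrtrM ?sqr_ge0 // sqrtr_sqr (gtr0_norm c0).
have q0 := pd_gt0 v0.
rewrite -{2}(sqr_sqrtr (ltW q0)).
have r0 : 0 < Num.sqrt (bilin v S v) by rewrite sqrtr_gt0.
have hr : delta * sigma < Num.sqrt (bilin v S v).
  by rewrite -(ger0_norm (ltW ds0)) -sqrtr_sqr ltr_sqrt.
set r := Num.sqrt _ in r0 hr *.
have -> : (sigma * (c * r))^-1 * (c * r ^+ 2) = r / sigma.
  by field; rewrite ?gt_eqF.
by rewrite gtr0_norm ?divr_gt0 // ltr_pdivlMr.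
Qed.

End PositiveDefinite.
End Gram.

(** * The estimator for a fixed noise vector *)

Section Deterministic.
Context {R : realType}.

Lemma dot_split k m (u v : 'cV[R]_(k + m)) :
  dot u v = dot (usubmx u) (usubmx v) + dot (dsubmx u) (dsubmx v).
Proof.
rewrite !dotE big_split_ord /=.
by congr (_ + _); apply: eq_bigr => i _; rewrite !mxE.
Qed.

Lemma sum_norm_le k (u : 'cV[R]_k) :
  \sum_j `|u j 0| <= Num.sqrt k%:R * Num.sqrt (dot u u).
Proof.
pose v : 'cV[R]_k := \col_j `|u j 0|.
have -> : \sum_j `|u j 0| = dot (const_mx 1) v.
  by rewrite dotE; apply: eq_bigr => j _; rewrite !mxE mul1r.
have -> : dot u u = dot v v.
  by rewrite !dotE; apply: eq_bigr => j _; rewrite !mxE -!expr2 real_normK // num_real.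
have -> : k%:R = dot (const_mx 1 : 'cV[R]_k) (const_mx 1).
  rewrite dotE (eq_bigr (fun=> 1)) ?sumr_const ?card_ord //.
  by move=> j _; rewrite !mxE mulr1.
by apply: le_trans (dot_ler _ _); rewrite ler_norm.
Qed.

Section FixedSampleSize.
Variables (n k m : nat) (X : 'M[R]_(n, k + m)) (gamma lambda : R).
Variables (beta10 : 'cV[R]_k) (e : nat -> R) (b : 'cV[R]_(k + m)).
Variables (b0 b1 M : R).

Let beta0 : 'cV[R]_(k + m) := col_mx beta10 0.
Let E : 'cV[R]_n := \col_i e i.
Let h := b - beta0.
Let rho := min_eigenvalue (gram X).
(** The target rate [sqrt (p / n) / rho]. *)
Let H := Num.sqrt (k + m)%:R / (rho * Num.sqrt n%:R).
(** The constant in the rate: [2 * M] comes from the noise, the other term is the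
    Lipschitz constant of the penalty at distance [b0 / 2] from 0. *)
Let K := 2 * M + (b0 / 2) `^ (gamma - 1).

Hypotheses (n_gt0 : (0 < n)%N) (Hgamma : 0 < gamma < 1) (lambda_ge0 : 0 <= lambda).
Hypotheses (sX : standardized X) (rho_gt0 : 0 < rho) (b0_gt0 : 0 < b0).
Hypotheses (beta10_low : forall j, b0 <= `|beta10 j 0|).
Hypotheses (beta10_upp : forall j, `|beta10 j 0| <= b1).
Hypotheses (b_min : is_minimizer gamma lambda X (response X beta0 e) b).
Hypotheses (M_ge0 : 0 <= M).
Hypothesis good : dot (X^T *m E) (X^T *m E) <= M ^+ 2 * (n%:R * (k + m)%:R).

Let N0 : (0 : R) < n%:R. Proof. by rewrite ltr0n. Qed.
Let sN0 : 0 < Num.sqrt n%:R :> R. Proof. by rewrite sqrtr_gt0. Qed.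
Let H_ge0 : 0 <= H.
Proof. by rewrite divr_ge0 ?sqrtr_ge0 // mulr_ge0 ?sqrtr_ge0 ?(ltW rho_gt0). Qed.

Let NrhoH : n%:R * rho * H = Num.sqrt n%:R * Num.sqrt (k + m)%:R.
Proof.
rewrite /H -{1}(sqr_sqrtr (ltW N0)).
by field; rewrite ?gt_eqF.
Qed.

Let noise_le : Num.sqrt (dot (X^T *m E) (X^T *m E)) <= M * (n%:R * rho * H).
Proof.
rewrite NrhoH -(ger0_norm M_ge0) -sqrtr_sqr -!sqrtrM ?ler0n ?sqr_ge0 //.
by rewrite ler_wsqrtr.
Qed.

Let t := Num.sqrt (dot h h).
Let t_ge0 : 0 <= t. Proof. exact: sqrtr_ge0. Qed.
Let t2 : t ^+ 2 = dot h h. Proof. by rewrite sqr_sqrtr ?dot_ge0. Qed.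

Let prediction_le : dot (X *m h) (X *m h) <= 2 * (M * (n%:R * rho * H)) * t
  + lambda * (\sum_j `|beta0 j 0| `^ gamma - \sum_j `|b j 0| `^ gamma).
Proof.
apply: le_trans (basic_inequality b_min) _.
rewrite lerD2r -mulrA ler_wpM2l //.
apply: le_trans (ler_norm _) _; apply: le_trans (dot_ler _ _) _.
by rewrite ler_wpM2r ?sqrtr_ge0.
Qed.

Let curvature : n%:R * rho * t ^+ 2 <= dot (X *m h) (X *m h).
Proof. by rewrite t2; apply: min_eigenvalue_gram. Qed.

Let beta0_penalty : \sum_j `|beta0 j 0| `^ gamma = \sum_j `|beta10 j 0| `^ gamma.
Proof.
rewrite big_split_ord /= [X in _ + X]big1 ?addr0 => [|j _].
  by apply: eq_bigr => j _; rewrite col_mxEu.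
by rewrite col_mxEd mxE normr0 powR0 ?gt_eqF //; case/andP: Hgamma.
Qed.

(** The penalty of the true parameter is at most [k * b1 `^ gamma], and the term
    linear in [t] is absorbed into half of the quadratic one. *)
Lemma consistency_bound :
  dot h h <= 4 * M ^+ 2 * H ^+ 2
             + 2 * b1 `^ gamma * (lambda * k%:R / (n%:R * rho)).
Proof.
have pen : \sum_j `|beta0 j 0| `^ gamma - \sum_j `|b j 0| `^ gamma
    <= k%:R * b1 `^ gamma.
  rewrite beta0_penalty; apply: (@le_trans _ _ (\sum_j `|beta10 j 0| `^ gamma)).
    by rewrite gerBl sumr_ge0 // => j _; rewrite powR_ge0.
  have -> : k%:R * b1 `^ gamma = \sum_(j < k) b1 `^ gamma.
    by rewrite sumr_const card_ord mulr_natl.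
  case/andP: Hgamma => g0 _; apply: ler_sum => j _.
  rewrite ge0_ler_powR ?nnegrE ?(ltW g0) //.
  by rewrite (le_trans _ (beta10_upp j)).
have h1 := le_trans curvature prediction_le.
have h2 := ler_wpM2l lambda_ge0 pen.
have r0 : 0 < n%:R * rho by rewrite mulr_gt0.
rewrite -t2 -(ler_pM2l r0).
have -> : n%:R * rho * (4 * M ^+ 2 * H ^+ 2
     + 2 * b1 `^ gamma * (lambda * k%:R / (n%:R * rho)))
   = n%:R * rho * (4 * M ^+ 2 * H ^+ 2) + 2 * (lambda * (k%:R * b1 `^ gamma)).
  by field; rewrite ?gt_eqF.
have : 0 <= n%:R * rho * (t - 2 * M * H) ^+ 2 by rewrite mulr_ge0 ?sqr_ge0 ?(ltW r0).
move: h1 h2; set r := n%:R * rho; set a := lambda * (_ - _); set d := lambda * (_ * _).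
lra.
Qed.

Hypothesis close : dot h h <= (b0 / 2) ^+ 2.

Let entry_close j : `|h j 0| <= b0 / 2.
Proof.
have c0 : 0 <= b0 / 2 by rewrite divr_ge0 // ltW.
rewrite -(ger0_norm c0) -ler_sqr ?nnegrE // !real_normK ?num_real //.
exact: le_trans (entry_sqr_le_dot h j) close.
Qed.

Let active_entry j : b (lshift m j) 0 = beta10 j 0 + h (lshift m j) 0.
Proof. by rewrite /h /beta0 [in RHS]mxE [in RHS]mxE col_mxEu subrKC. Qed.

(** An error smaller than half the smallest signal cannot bring an active
    coefficient close to 0. *)
Lemma active_low j : b0 / 2 <= `|b (lshift m j) 0|.
Proof.
have := entry_close (lshift m j); have := beta10_low j; rewrite active_entry.
by have := lerB_normD (beta10 j 0) (h (lshift m j) 0); lra.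
Qed.

Hypothesis lambda_le : lambda * Num.sqrt k%:R <= Num.sqrt n%:R.
Hypothesis p_gt0 : (0 < k + m)%N.

Let penalty_le : \sum_j `|beta0 j 0| `^ gamma - \sum_j `|b j 0| `^ gamma
  <= (b0 / 2) `^ (gamma - 1) * (Num.sqrt k%:R * t).
Proof.
case/andP: Hgamma => g0 g1.
rewrite beta0_penalty big_split_ord /= opprD addrA lerBlDr.
rewrite ler_wpDr ?sumr_ge0 // -sumrB.
apply: (@le_trans _ _ (\sum_j (b0 / 2) `^ (gamma - 1) * `|usubmx h j 0|)).
  apply: ler_sum => j _; apply: le_trans (ler_norm _) _.
  have c0 : 0 < b0 / 2 by rewrite divr_gt0.
  have l1 : b0 / 2 <= `|beta10 j 0| by have := beta10_low j; lra.
  have g01 : 0 < gamma <= 1 by rewrite g0 ltW.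
  apply: le_trans (powR_lipschitz g01 c0 l1 (active_low j)) _.
  rewrite ler_wpM2l ?powR_ge0 // (le_trans (ler_dist_dist _ _)) //.
  by rewrite [usubmx h j 0]mxE active_entry opprD addrA subrr sub0r normrN.
rewrite -mulr_sumr ler_wpM2l ?powR_ge0 // (le_trans (sum_norm_le _)) //.
by rewrite ler_wpM2l ?sqrtr_ge0 // ler_wsqrtr // [leRHS]dot_split lerDl dot_ge0.
Qed.

Let prediction_linear : dot (X *m h) (X *m h) <= K * (n%:R * rho * H) * t.
Proof.
apply: le_trans prediction_le _.
have h1 := ler_wpM2l lambda_ge0 penalty_le.
have h2 : lambda * Num.sqrt k%:R <= n%:R * rho * H.
  apply: le_trans lambda_le _; rewrite NrhoH ler_peMr ?sqrtr_ge0 //.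
  by rewrite -[leLHS]sqrtr1 ler_wsqrtr // ler1n.
have h3 : 0 <= (b0 / 2) `^ (gamma - 1) * t by rewrite mulr_ge0 ?powR_ge0.
have h4 := ler_wpM2l h3 h2.
rewrite /K; move: h1 h4; set L := _ `^ _; set D := _ - _; set r := n%:R * rho * H.
lra.
Qed.

Let K_ge0 : 0 <= K.
Proof. by rewrite addr_ge0 ?powR_ge0 // mulr_ge0. Qed.

(** Both sides of the basic inequality are now proportional to the norm [t] of the
    error, one of them quadratically. *)
Lemma estimation_rate : t <= K * H.
Proof.
have [->|t0] := eqVneq t 0; first by rewrite mulr_ge0.
have tp : 0 < t by rewrite lt_neqAle eq_sym t0 t_ge0.
have r0 : 0 < n%:R * rho by rewrite mulr_gt0.
rewrite -(ler_pM2r tp) -(ler_pM2l r0).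
by have := le_trans curvature prediction_linear; lra.
Qed.

Let column_sqr j : \sum_i X i j ^+ 2 = n%:R.
Proof.
have [_ /(congr1 ( *%R n%:R))] := sX j.
by rewrite mulVKf ?gt_eqF // mulr1.
Qed.

Let rho_le1 : rho <= 1. Proof. exact: min_eigenvalue_le1. Qed.

Let prediction_rate : Num.sqrt (dot (X *m h) (X *m h)) <= K * (Num.sqrt n%:R * H).
Proof.
have q0 : 0 <= K * (Num.sqrt n%:R * H) by rewrite mulr_ge0 // mulr_ge0 // sqrtr_ge0.
rewrite -(ger0_norm q0) -sqrtr_sqr ler_wsqrtr //.
apply: le_trans prediction_linear _.
rewrite exprMn [(_ * H) ^+ 2]exprMn sqr_sqrtr ?(ltW N0) //.
apply: (@le_trans _ _ (K * (n%:R * 1 * H) * (K * H))); last by lra.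
have hK : 0 <= n%:R * H by rewrite mulr_ge0 ?(ltW N0).
apply: ler_pM => //; last exact: estimation_rate.
- by rewrite mulr_ge0 // mulr_ge0 // mulr_ge0 ?(ltW N0) ?(ltW rho_gt0).
- by rewrite ler_wpM2l // ler_wpM2r // ler_wpM2l ?(ltW N0).
Qed.

Let score_le j :
  `|(X^T *m residual X (response X beta0 e) b) j 0| <= (M + K) * (n%:R * H).
Proof.
have entry (u : 'cV[R]_(k + m)) : `|u j 0| <= Num.sqrt (dot u u).
  by rewrite -sqrtr_sqr ler_wsqrtr // entry_sqr_le_dot.
rewrite residual_response -/E -/h mulmxBr [X in `|X|]mxE [X in `|_ + X|]mxE.
apply: le_trans (ler_normB _ _) _; rewrite mulrDl lerD //.
  apply: le_trans (entry _) _; apply: le_trans noise_le _.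
  by rewrite ler_wpM2l // ler_wpM2r // ler_piMr ?(ltW N0).
have -> : (X^T *m (X *m h)) j 0 = dot (col j X) (X *m h).
  by rewrite dotE mxE; apply: eq_bigr => i _; rewrite [in LHS]mxE [in RHS]mxE.
apply: le_trans (dot_ler _ _) _.
have -> : dot (col j X) (col j X) = n%:R.
  by rewrite dotE -(column_sqr j); apply: eq_bigr => i _; rewrite mxE expr2.
apply: le_trans (ler_wpM2l (sqrtr_ge0 _) prediction_rate) _.
have -> : K * (n%:R * H) = K * (Num.sqrt n%:R * Num.sqrt n%:R * H).
  by rewrite -expr2 sqr_sqrtr ?(ltW N0).
by rewrite le_eqVlt; apply/orP; left; apply/eqP; ring.
Qed.

(** A nonzero inactive coefficient has size at most [K * H], and the score of the
    residual is of order [n * H]: together they bound [lambda] by the left-hand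
    side. *)
Lemma inactive_coefficients_zero :
  K `^ (1 - gamma) * (2 * (M + K) + K) * (n%:R * H `^ (2 - gamma)) < lambda ->
  dsubmx b = 0.
Proof.
case/andP: Hgamma => g0 g1 hl; apply/colP => j; rewrite [RHS]mxE [LHS]mxE.
set i := rshift k j; apply/eqP; apply: contraTT hl => bi; rewrite -leNgt.
have hi : h i 0 = b i 0 by rewrite /h /beta0 [LHS]mxE [X in _ + X]mxE col_mxEd mxE oppr0 addr0.
have bH : `|b i 0| <= K * H.
  rewrite -hi; apply: le_trans estimation_rate.
  by rewrite -sqrtr_sqr ler_wsqrtr // entry_sqr_le_dot.
apply: le_trans (nonzero_coordinate g0 b_min bi) _; rewrite column_sqr.
have H2 : H `^ (2 - gamma) = H `^ (1 - gamma) * H.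
  rewrite -[X in _ * X](powRr1 H_ge0) -powRD; first by congr (_ `^ _); ring.
  by apply/implyP => /eqP; lra.
rewrite H2.
have -> : K `^ (1 - gamma) * (2 * (M + K) + K) * (n%:R * (H `^ (1 - gamma) * H))
   = (K * H) `^ (1 - gamma) * (2 * ((M + K) * (n%:R * H)) + K * H * n%:R).
  by rewrite powRM //; ring.
apply: ler_pM; rewrite ?powR_ge0 //.
- have KH0 : 0 <= K * H := mulr_ge0 K_ge0 H_ge0.
  by apply: ge0_ler_powR; rewrite ?nnegrE ?subr_ge0 ?(ltW g1) ?normr_ge0 ?KH0.
- apply: lerD; first by rewrite ler_wpM2l // score_le.
  by rewrite ler_wpM2r ?(ltW N0).
Qed.

Let W := lsubmx X.

(** Once [dsubmx b = 0], [v] is the image of the residual score of the active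
    covariates under the inverse Gram matrix, up to the factor [- (sqrt n)^-1]. *)
Lemma remainder_bound tau v : dsubmx b = 0 -> 0 < tau -> tau <= min_eigenvalue (gram W) ->
  v = Num.sqrt n%:R *: (usubmx b - beta10)
      - (Num.sqrt n%:R)^-1 *: (invmx (gram W) *m (W^T *m E)) ->
  bilin v (gram W) v
    <= (4 * tau)^-1 * (b0 / 4) `^ (gamma - 1) ^+ 2 * (lambda ^+ 2 * (k%:R / n%:R)).
Proof.
case/andP: Hgamma => g0 g1 hd tau0 htau vdef.
have symS := gram_sym W.
have uS := pd_unit symS tau0 htau.
pose r := W^T *m residual X (response X beta0 e) b.
have Xh : X *m h = W *m (usubmx b - beta10).
  have -> : h = col_mx (usubmx b - beta10) 0.
    by rewrite -[h]vsubmxK /h /beta0 linearB linearB /= col_mxKu col_mxKd hd subrr.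
  by rewrite -[X]hsubmxK mul_row_col mulmx0 addr0.
have hr : r = W^T *m E - n%:R *: (gram W *m (usubmx b - beta10)).
  rewrite /r residual_response -/E -/h Xh mulmxBr /gram -scalemxAl scalerA.
  by rewrite mulfV ?gt_eqF // scale1r mulmxA.
have vE : v = - (Num.sqrt n%:R)^-1 *: (invmx (gram W) *m r).
  have nn : (Num.sqrt n%:R)^-1 * n%:R = Num.sqrt n%:R :> R.
    by rewrite -{2}(sqr_sqrtr (ltW N0)) expr2 mulKf ?gt_eqF.
  rewrite hr mulmxBr -scalemxAr mulKmx // scalerBr scalerA vdef mulNr nn !scaleNr.
  by rewrite opprK addrC.
have -> : bilin v (gram W) v = n%:R^-1 * bilin r (invmx (gram W)) r.
  rewrite vE (pd_inv symS tau0 htau) !bilin_dot -scalemxAr dotZl dotZr mulrA.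
  by rewrite mulrNN -invfM -expr2 sqr_sqrtr ?(ltW N0).
have rj j : r j 0 ^+ 2 <= (lambda * (b0 / 4) `^ (gamma - 1) / 2) ^+ 2.
  have -> : r j 0 = (X^T *m residual X (response X beta0 e) b) (lshift m j) 0.
    rewrite /r mxE [RHS]mxE; apply: eq_bigr => i _; rewrite !mxE; congr (_ * _).
  have c0 : 0 < b0 / 4 by rewrite divr_gt0.
  have cb : 2 * (b0 / 4) <= `|b (lshift m j) 0|.
    by have := active_low j; move: (b0 : R) => c; lra.
  have g01 : 0 < gamma <= 1 by rewrite g0 ltW.
  have := score_bound g01 lambda_ge0 b_min c0 cb.
  set u := (_ *m _) _ _; set L := _ `^ _ => hu.
  rewrite -(real_normK (num_real u)) ler_sqr ?nnegrE ?normr_ge0 //; first by lra.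
  by rewrite divr_ge0 // mulr_ge0 ?powR_ge0.
have rr : dot r r <= k%:R * (lambda * (b0 / 4) `^ (gamma - 1) / 2) ^+ 2.
  rewrite dotE mulr_natl -[X in _ *+ X]card_ord -sumr_const.
  by apply: ler_sum => j _; rewrite -expr2.
have hq := pd_inv_upper symS tau0 htau r.
have : n%:R^-1 * bilin r (invmx (gram W)) r
  <= n%:R^-1 * (tau^-1 * (k%:R * (lambda * (b0 / 4) `^ (gamma - 1) / 2) ^+ 2)).
  rewrite ler_wpM2l ?invr_ge0 ?(ltW N0) // (le_trans hq) //.
  by rewrite ler_wpM2l // invr_ge0 ltW.
move/le_trans; apply; rewrite le_eqVlt; apply/orP; left; apply/eqP.
by field; rewrite ?gt_eqF.
Qed.

End FixedSampleSize.
End Deterministic.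

(** * Independence of a weighted sum from the next noise variable *)

Section Independence.
Context (R : realType) (d : measure_display) (T : measurableType d).
Variable P : probability T R.

Definition independent_pair (X Y : T -> R) :=
  forall A B : set R, measurable A -> measurable B ->
    P (X @^-1` A `&` Y @^-1` B) = (P (X @^-1` A) * P (Y @^-1` B))%E.

(** The joint law is the product of the marginal laws since both agree on
    rectangles; the rest is Tonelli. *)
Lemma integral_independent_pair (X Y : T -> R) (F : R * R -> \bar R) :
  measurable_fun setT X -> measurable_fun setT Y -> independent_pair X Y ->
  measurable_fun setT F -> (forall z, 0 <= F z)%E ->
  (\int[P]_w F (X w, Y w) = \int[P]_w \int[P]_w' F (X w, Y w'))%E.
Proof.
move=> mX mY ind mF F0.
pose Xm := HB.pack_for {mfun T >-> R} X (isMeasurableFun.Build _ _ _ _ X mX).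
pose Ym := HB.pack_for {mfun T >-> R} Y (isMeasurableFun.Build _ _ _ _ Y mY).
have mXY : measurable_fun setT (fun w => (X w, Y w)).
  exact: measurable_fun_pair.
pose Zm := HB.pack_for {mfun T >-> (R * R)%type} (fun w => (X w, Y w))
  (isMeasurableFun.Build _ _ _ _ (fun w => (X w, Y w)) mXY).
have prod_law (A : set (R * R)) : measurable A ->
    (distribution P Xm \x distribution P Ym)%E A = distribution P Zm A.
  apply: product_measure_unique => B C mB mC.
  by rewrite -[RHS](ind B C mB mC) /distribution /pushforward /=.
have -> : (\int[P]_w F (X w, Y w) = \int[distribution P Zm]_z F z)%E.
  by rewrite (ge0_integral_distribution Zm).
have -> : (\int[distribution P Zm]_z F z
    = \int[(distribution P Xm \x distribution P Ym)%E]_z F z)%E.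
  by apply: eq_measure_integral => A mA _; exact/esym/prod_law.
rewrite fubini_tonelli1 //.
rewrite (ge0_integral_distribution Xm) //; last 2 first.
- exact: measurable_fun_fubini_tonelli_F.
- by move=> x; apply: integral_ge0.
apply: eq_integral => w _ /=; rewrite /fubini_F (ge0_integral_distribution Ym) //.
by apply: measurableT_comp => //; exact: measurable_fun_pair.
Qed.

Variable eps : nat -> {RV P >-> R}.
Hypothesis indep : independent_RVs eps.

(** Rectangles in the first [n] variables: a pi-system that generates the sigma-algebra
    for which weighted sums of these variables are measurable. *)
Let past (n : nat) : set (set T) :=
  [set B | exists2 A : nat -> set R, (forall j, measurable (A j)) &
     B = \bigcap_(j in [set` iota 0 n]) (eps j @^-1` A j)].

Let past_measurable n : past n `<=` measurable.
Proof.
move=> _ [A mA ->]; apply: fin_bigcap_measurable; first exact: finite_seq.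
by move=> j _; rewrite -[X in measurable X]setTI; exact: measurable_funP.
Qed.

Let past_setT n : past n setT.
Proof.
exists (fun=> setT) => //; apply/esym; rewrite -subTset => w _ j _ //.
Qed.

Let past_setI n : setI_closed (past n).
Proof.
move=> _ _ [A mA ->] [B mB ->]; exists (fun j => A j `&` B j).
  by move=> j; exact: measurableI.
by rewrite -bigcapI; apply: eq_bigcapr => j _; rewrite preimage_setI.
Qed.

(** Both sides are finite measures of [B] that agree on the past rectangles,
    which are stable under intersection. *)
Let past_independent n (C : set R) (B : set T) : measurable C -> <<s past n >> B ->
  P (B `&` eps n @^-1` C) = (P (eps n @^-1` C) * P B)%E.
Proof.
move=> mC.
have mD : measurable (eps n @^-1` C).
  by rewrite -[X in measurable X]setTI; exact: measurable_funP.
have r0 : 0 <= fine (P (eps n @^-1` C)) by rewrite fine_ge0.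
pose m1 : {measure set T -> \bar R} := mrestr P mD.
pose m2 : {measure set T -> \bar R} := mscale (NngNum r0) P.
have -> : P (B `&` eps n @^-1` C) = m1 B by [].
have -> : (P (eps n @^-1` C) * P B)%E = m2 B.
  by rewrite /m2 /= /mscale /= fineK // fin_num_measure.
apply: (g_sigma_algebra_measure_unique (past n) _ (fun=> setT)) => //.
- by rewrite bigcup_const //; exists 0%N.
- move=> _ [A mA ->]; rewrite /m1 /m2 /= /mrestr /mscale /= fineK ?fin_num_measure //.
  rewrite indep ?iota_uniq //.
  pose A' j := if j == n then C else A j.
  have mA' j : measurable (A' j) by rewrite /A'; case: eqP.
  have -> : \bigcap_(j in [set` iota 0 n]) (eps j @^-1` A j) `&` eps n @^-1` C
      = \bigcap_(j in [set` iota 0 n.+1]) (eps j @^-1` A' j).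
    rewrite -addn1 iotaD add0n /=; apply/seteqP; split=> w.
      move=> [h1 h2] j /=; rewrite mem_cat inE => /orP[hj|/eqP ->].
        rewrite /A' ifN; first exact: h1.
        by move: hj; rewrite mem_iota add0n => /andP[_]; case: ltngtP.
      by rewrite /A' eqxx.
    move=> h; split=> [j hj|].
      have := h j; rewrite /= mem_cat hj => /(_ isT).
      rewrite /A' ifN //.
      by move: hj; rewrite /= mem_iota add0n => /andP[_]; case: ltngtP.
    by have := h n; rewrite /= mem_cat inE eqxx orbT /A' eqxx; exact.
  rewrite indep ?iota_uniq // -addn1 iotaD add0n big_cat /= big_seq1 {2}/A' eqxx muleC.
  congr (_ * _)%E; rewrite !big_seq; apply: eq_bigr => j.
  rewrite mem_iota add0n => /andP[_ jn]; rewrite /A' ifN //.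
  by case: ltngtP jn.
- by move=> _; rewrite /m1 /= /mrestr setTI ltey_eq fin_num_measure.
Qed.

Lemma measurable_lin_comb (c : nat -> R) n :
  measurable_fun setT (fun w => \sum_(j < n) c j * eps j w).
Proof.
apply: measurable_sum => j; apply: measurable_funM => //.
Qed.

Lemma lin_comb_independent (c : nat -> R) n :
  independent_pair (fun w => \sum_(j < n) c j * eps j w) (eps n).
Proof.
move=> A B mA mB; rewrite past_independent 1?muleC //.
pose TG := g_sigma_algebraType (past n).
have meps (j : 'I_n) : measurable_fun (setT : set TG) (eps j : TG -> R).
  move=> _ C mC; rewrite setTI; apply: sub_sigma_algebra.
  exists (fun i : nat => if i == j :> nat then C else setT).
    by move=> i; case: eqP.
  apply/seteqP; split=> w.
    by move=> h i _ /=; case: eqP => // ->.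
  move=> /(_ j) /=; rewrite eqxx; apply.
  by rewrite mem_iota add0n /=.
have mS : measurable_fun (setT : set TG) (fun w : TG => \sum_(j < n) c j * eps j w).
  by apply: measurable_sum => j; apply: measurable_funM => //; exact: meps.
by have := mS measurableT A mA; rewrite setTI.
Qed.

End Independence.

(** * The normal distribution function and the heat equation *)

Section NormalCdf.
Context {R : realType}.
Implicit Types x y : R.

Notation phi := (@normal_pdf R 0 1).

Definition Phi y : R := fine (normal_prob 0 1 `]-oo, y]).

Lemma Phi_normal_prob y : (Phi y)%:E = normal_prob 0 1 `]-oo, y].
Proof. by rewrite fineK // fin_num_measure. Qed.

Lemma Phi_ge0 y : 0 <= Phi y.
Proof. by rewrite -lee_fin Phi_normal_prob. Qed.

Lemma Phi_le1 y : Phi y <= 1.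
Proof. by rewrite -lee_fin Phi_normal_prob probability_le1. Qed.

Lemma Phi_homo x y : x <= y -> Phi x <= Phi y.
Proof.
move=> xy; rewrite -lee_fin !Phi_normal_prob le_measure ?inE //.
by apply: subset_itvl; rewrite bnd_simp.
Qed.

Lemma phiE x : phi x = normal_peak 1 * expR (- x ^+ 2 / 2).
Proof.
by rewrite normal_pdfE ?oner_neq0 // /normal_fun subr0 expr1n.
Qed.

Lemma is_derive_Phi x : is_derive x 1 Phi (phi x).
Proof.
have -> : Phi = fun y => (\int[lebesgue_measure]_(t in `]-oo, y]) phi t)%R.
  by apply/funext => y.
have xx1 : x < x + 1 by rewrite ltrDl.
have [] := @continuous_FTC1 R phi -oo%O x (x + 1) xx1.
- apply: (integrableS measurableT) => //; apply: integrable_normal_pdf.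
- exact: ltNyr.
- exact/continuous_normal_pdf/oner_neq0.
by move=> h1 h2; split; [exact: h1|rewrite -derive1E].
Qed.

Lemma is_derive_phi x : is_derive x 1 phi (- x * phi x).
Proof.
have -> : phi = fun y => normal_peak 1 * expR (- y ^+ 2 / 2).
  by apply/funext => y; exact: phiE.
apply: is_derive_eq.
rewrite /GRing.scale /=.
by field.
Qed.

Lemma Phi_tails (e : R) : 0 < e ->
  exists2 M, 0 < M & forall y, M <= y -> 1 - Phi y <= e /\ Phi (- y) <= e.
Proof.
move=> e0.
pose id' : measurableTypeR R -> R := idfun.
pose X := HB.pack_for {mfun (measurableTypeR R) >-> R} id'
  (isMeasurableFun.Build _ _ _ _ id' (@measurable_id _ _ setT)).
have /fine_cvgP[_ /cvgrPdist_le /(_ e e0)] :=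
  cvg_cdfy1 (X : {RV (normal_prob 0 1 : probability _ R) >-> R}).
move=> [M1 [_ h1]].
have /fine_cvgP[_ /cvgrPdist_le /(_ e e0)] :=
  cvg_cdfNy0 (X : {RV (normal_prob 0 1 : probability _ R) >-> R}).
move=> [M2 [_ h2]].
have := ler_norm M1; have := ler_norm (- M2); rewrite normrN => l2 l1.
have n1 := normr_ge0 M1; have n2 := normr_ge0 M2.
exists (`|M1| + `|M2| + 1); first by lra.
move=> y My; split.
  have lt1 : M1 < y by lra.
  have h : `|1 - Phi y| <= e := h1 y lt1.
  exact: le_trans (ler_norm _) h.
have lt2 : - y < M2 by lra.
have : `|0 - Phi (- y)| <= e := h2 (- y) lt2.
by rewrite sub0r normrN; apply: le_trans; exact: ler_norm.
Qed.

Lemma normal_peak1_le1 : normal_peak 1 <= 1 :> R.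
Proof.
rewrite /normal_peak invf_le1 ?sqrtr_gt0; last first.
  by rewrite expr1n mul1r mulrn_wgt0 // pi_gt0.
rewrite -[leLHS]sqrtr1 ler_wsqrtr // expr1n mul1r.
have := @pi_ge2 R; rewrite mulr2n; lra.
Qed.

Lemma phi_ge0 x : 0 <= phi x. Proof. exact: normal_pdf_ge0. Qed.

(** The exponential [expR (x ^+ 2 / 2)] is the square of [expR (x ^+ 2 / 4)], which
    is at least [1 + x ^+ 2 / 4]. *)
Lemma phi_moment4 x : (1 + x ^+ 2 / 4) ^+ 2 * phi x <= 1.
Proof.
have h : 0 <= 1 + x ^+ 2 / 4 by rewrite addr_ge0 // divr_ge0 ?sqr_ge0.
have -> : phi x = normal_peak 1 * (expR (x ^+ 2 / 4) ^+ 2)^-1.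
  by rewrite phiE mulNr expRN -expRM_natl; congr (_ * (expR _)^-1); lra.
have E0 : 0 < expR (x ^+ 2 / 4) ^+ 2 by rewrite exprn_gt0 ?expR_gt0.
rewrite mulrCA mulr_ile1 ?normal_peak_ge0 ?normal_peak1_le1 //.
  by rewrite divr_ge0 ?sqr_ge0 ?(ltW E0).
by rewrite ler_pdivrMr // mul1r lerXn2r ?nnegrE ?expR_ge0 ?expR_ge1Dx.
Qed.

Lemma phi_bounds x :
  [/\ phi x <= 1, `|x| * phi x <= 2, x ^+ 2 * phi x <= 2 & `|x| ^+ 3 * phi x <= 9].
Proof.
have := phi_moment4 x; have := phi_ge0 x; set f := phi x => f0 h.
have x2 : x ^+ 2 = `|x| ^+ 2 by rewrite real_normK ?num_real.
rewrite x2 in h *; have := normr_ge0 x; move: h; set a := `|x| => h a0.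
have p1 : 0 <= f * a ^+ 2 by rewrite mulr_ge0 ?sqr_ge0.
have p2 : 0 <= f * (a ^+ 2) ^+ 2 by rewrite mulr_ge0 ?sqr_ge0.
have p3 : 0 <= f * (1 - a) ^+ 2 by rewrite mulr_ge0 ?sqr_ge0.
have p4 : 0 <= f * (a * (1 - a)) ^+ 2 by rewrite mulr_ge0 ?sqr_ge0.
by split; lra.
Qed.

#[local] Existing Instance is_derive_Phi.
#[local] Existing Instance is_derive_phi.

(** Applied repeatedly, this replaces Taylor's formula with remainder; the constants
    are not optimal, but only their existence matters. *)
Lemma growth_from_derivative (h h' : R -> R) (C : R) (k : nat) :
  h 0 = 0 -> (forall y, is_derive y 1 h (h' y)) ->
  (forall y, `|h' y| <= C * `|y| ^+ k) -> forall y, `|h y| <= C * `|y| ^+ k.+1.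
Proof.
move=> h0 dh bh y.
have hc : continuous h.
  by move=> x; apply/differentiable_continuous/derivable1_diffP; have [] := dh x.
have [c ylt ->] : exists2 c, `|c| <= `|y| & h y = h' c * y.
  have [y0|y0] := leP 0 y.
    have [c] := MVT_segment y0 (fun x _ => dh x) (continuous_subspaceT hc).
    rewrite in_itv /= h0 !subr0 => /andP[c0 cy] ->; exists c => //.
    by rewrite !ger0_norm.
  have [c] := MVT_segment (ltW y0) (fun x _ => dh x) (continuous_subspaceT hc).
  rewrite in_itv /= h0 !sub0r => /andP[cy c0] hh; exists c.
    by rewrite !ler0_norm ?lerN2 // ltW.
  by rewrite -[h y]opprK hh mulrN opprK.
rewrite normrM exprSr mulrA ler_wpM2r // (le_trans (bh c)) //.
have [C0|C0] := leP 0 C; first by rewrite ler_wpM2l // lerXn2r ?nnegrE.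
have := bh 1; rewrite normr1 expr1n mulr1 => /(le_trans (normr_ge0 _)).
by rewrite leNgt C0.
Qed.

(** The cubic bound serves for small increments, the quadratic one where only
    second moments are available. *)
Lemma taylor2 (f f1 f2 f3 : R -> R) (K2 K3 : R) :
  (forall x, is_derive x 1 f (f1 x)) -> (forall x, is_derive x 1 f1 (f2 x)) ->
  (forall x, is_derive x 1 f2 (f3 x)) ->
  (forall x, `|f2 x| <= K2) -> (forall x, `|f3 x| <= K3) ->
  forall x y, `|f (x + y) - f x - f1 x * y - f2 x * y ^+ 2 / 2| <= K3 * `|y| ^+ 3
   /\ `|f (x + y) - f x - f1 x * y - f2 x * y ^+ 2 / 2| <= 2 * K2 * `|y| ^+ 2.
Proof.
move=> d0 d1 d2 b2 b3 x y.
have shift (g g' : R -> R) : (forall z : R, is_derive z 1 g (g' z)) ->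
    forall z : R, is_derive z 1 (fun y => g (x + y)) (g' (x + z)).
  move=> dg z; have dz := dg (x + z).
  have da : is_derive z (1 : R) (fun y => x + y) 1.
    by apply: is_derive_eq; rewrite add0r mulr1.
  by have := is_derive1_comp (f := g) (g := fun y => x + y) dz da; rewrite mulr1.
pose h2 y := f2 (x + y) - f2 x.
pose h1 y := f1 (x + y) - f1 x - f2 x * y.
pose h0 y := f (x + y) - f x - f1 x * y - f2 x * y ^+ 2 / 2.
have e2 (z : R) : is_derive z 1 h2 (f3 (x + z)).
  by have ? := shift _ _ d2 z; apply: is_derive_eq; rewrite subr0.
have e1 (z : R) : is_derive z 1 h1 (h2 z).
  have ? := shift _ _ d1 z; apply: is_derive_eq; rewrite /GRing.scale /= /h2; ring.
have e0 (z : R) : is_derive z 1 h0 (h1 z).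
  have ? := shift _ _ d0 z; apply: is_derive_eq; rewrite /GRing.scale /= /h1.
  by field.
have z2 : h2 0 = 0 by rewrite /h2 addr0 subrr.
have z1 : h1 0 = 0 by rewrite /h1 addr0 subrr mulr0 subr0.
have z0 : h0 0 = 0 by rewrite /h0 addr0 subrr expr0n /= !mulr0 mul0r !subr0.
have g2 z : `|h2 z| <= K3 * `|z| ^+ 1.
  by apply: growth_from_derivative z2 e2 _ z => w; rewrite mulr1.
have g2' z : `|h2 z| <= 2 * K2 * `|z| ^+ 0.
  rewrite mulr1 (le_trans (ler_normB _ _)) //.
  by have := b2 (x + z); have := b2 x; lra.
split.
  apply: (growth_from_derivative z0 e0) => z.
  exact: (growth_from_derivative z1 e1).
apply: (growth_from_derivative z0 e0) => z.
exact: (growth_from_derivative z1 e1).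
Qed.

Section HeatSolution.
Variable t : R.

(** As a function of [x], the indicator of [x <= t] smoothed by a centered normal
    law of variance [v]. *)
Definition smooth_cdf v x : R := Phi ((t - x) / Num.sqrt v).

Let z v x := (t - x) / Num.sqrt v.
(** The first and second derivatives in [x]; half the second one is the derivative
    in [v], which is the heat equation. *)
Definition smooth_cdf1 v x : R := - ((Num.sqrt v)^-1 * phi (z v x)).
Definition smooth_cdf2 v x : R := - (v^-1 * (z v x * phi (z v x))).

Let sqrt_neq0 (v : R) : 0 < v -> Num.sqrt v != 0.
Proof. by move=> v0; rewrite gt_eqF ?sqrtr_gt0. Qed.

Let invE (v : R) : 0 < v -> v^-1 = (Num.sqrt v)^-1 ^+ 2.
Proof. by move=> v0; rewrite exprVn sqr_sqrtr // ltW. Qed.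

Lemma is_derive_smooth_cdf (v x : R) : is_derive x 1 (smooth_cdf v) (smooth_cdf1 v x).
Proof.
rewrite /smooth_cdf; apply: is_derive_eq; rewrite /GRing.scale /= /smooth_cdf1 /z.
ring.
Qed.

Lemma is_derive_smooth_cdf1 (v x : R) : 0 < v ->
  is_derive x 1 (smooth_cdf1 v) (smooth_cdf2 v x).
Proof.
move=> v0.
rewrite /smooth_cdf1 /z; apply: is_derive_eq; rewrite /GRing.scale /= /smooth_cdf2 /z.
rewrite (invE v0); have s0 := sqrt_neq0 v0.
by set f := phi _; field.
Qed.

Lemma is_derive_smooth_cdf2 (v x : R) : 0 < v ->
  is_derive x 1 (smooth_cdf2 v)
     (v^-1 / Num.sqrt v * ((1 - z v x ^+ 2) * phi (z v x))).
Proof.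
move=> v0.
rewrite /smooth_cdf2 /z; apply: is_derive_eq; rewrite /GRing.scale /=.
rewrite (invE v0); have s0 := sqrt_neq0 v0.
by set f := phi _; field.
Qed.

Lemma is_derive_smooth_cdf_var (v x : R) : 0 < v ->
  is_derive v 1 (smooth_cdf ^~ x) (2^-1 * smooth_cdf2 v x).
Proof.
move=> v0; have s0 := sqrt_neq0 v0; have ds := is_derive1_sqrt v0.
rewrite /smooth_cdf /z; apply: is_derive_eq; rewrite /GRing.scale /= /smooth_cdf2 /z.
rewrite (invE v0).
by set f := phi _; field.
Qed.

Lemma is_derive_smooth_cdf2_var (v x : R) : 0 < v ->
  is_derive v 1 (smooth_cdf2 ^~ x)
    (v ^- 2 * ((3 / 2 * z v x - z v x ^+ 3 / 2) * phi (z v x))).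
Proof.
move=> v0; have s0 := sqrt_neq0 v0; have ds := is_derive1_sqrt v0.
have dv : is_derive v 1 (@GRing.inv R) (- v ^- 2 *: 1).
  by apply: (@is_deriveV R id v 1 1); rewrite ?gt_eqF.
rewrite /smooth_cdf2 /z; apply: is_derive_eq; rewrite /GRing.scale /=.
rewrite -!exprVn (invE v0).
by set f := phi _; field.
Qed.

Lemma smooth_cdf_taylor (V0 : R) : 0 < V0 ->
  exists2 K : R, 0 <= K & forall v x y, V0 <= v ->
  `|smooth_cdf v (x + y) - smooth_cdf v x - smooth_cdf1 v x * y
    - smooth_cdf2 v x * y ^+ 2 / 2| <= K * `|y| ^+ 3
  /\ `|smooth_cdf v (x + y) - smooth_cdf v x - smooth_cdf1 v x * y
        - smooth_cdf2 v x * y ^+ 2 / 2| <= K * `|y| ^+ 2.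
Proof.
move=> V00; have i0 : 0 <= V0^-1 by rewrite invr_ge0 ltW.
have j0 : 0 <= (Num.sqrt V0)^-1 by rewrite invr_ge0 sqrtr_ge0.
pose K3 := 3 * (V0^-1 / Num.sqrt V0); pose K2 := 2 / V0.
have K30 : 0 <= K3 by rewrite !mulr_ge0.
have K20 : 0 <= K2 by rewrite mulr_ge0.
exists (K3 + 2 * K2); first by lra.
move=> v x y Vv; have v0 : 0 < v := lt_le_trans V00 Vv.
have iv : v^-1 <= V0^-1 by rewrite lef_pV2.
have iv0 : 0 <= v^-1 by rewrite invr_ge0 ltW.
have jv : (Num.sqrt v)^-1 <= (Num.sqrt V0)^-1.
  by rewrite lef_pV2 ?posrE ?sqrtr_gt0 // ler_wsqrtr.
have jv0 : 0 <= (Num.sqrt v)^-1 by rewrite invr_ge0 sqrtr_ge0.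
have b2 u : `|smooth_cdf2 v u| <= K2.
  have [_ h _ _] := phi_bounds (z v u).
  rewrite normrN normrM (ger0_norm iv0) normrM (ger0_norm (phi_ge0 _)) mulrC.
  by apply: ler_pM => //; rewrite mulr_ge0 ?phi_ge0.
have b3 u : `|v^-1 / Num.sqrt v * ((1 - z v u ^+ 2) * phi (z v u))| <= K3.
  have [h1 _ h2 _] := phi_bounds (z v u); have f0 := phi_ge0 (z v u).
  rewrite normrM (ger0_norm (mulr_ge0 iv0 jv0)) mulrC; apply: ler_pM => //.
  - by rewrite mulr_ge0.
  - have zf : 0 <= z v u ^+ 2 * phi (z v u) by rewrite mulr_ge0 ?sqr_ge0.
    by rewrite mulrBl mul1r ler_norml; apply/andP; split; lra.
  - exact: ler_pM.
have [h1 h2] := taylor2 (is_derive_smooth_cdf v) (fun u => is_derive_smooth_cdf1 u v0)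
  (fun u => is_derive_smooth_cdf2 u v0) b2 b3 x y.
split; [apply: le_trans h1 _|apply: le_trans h2 _];
  rewrite ler_wpM2r ?exprn_ge0 //; lra.
Qed.

Lemma smooth_cdf_heat (V0 : R) : 0 < V0 ->
  exists2 K : R, 0 <= K & forall v s x, V0 <= v -> 0 <= s ->
  `|smooth_cdf (v + s) x - smooth_cdf v x - s / 2 * smooth_cdf2 v x| <= K * s ^+ 2.
Proof.
move=> V00; have i0 : 0 <= V0 ^- 2 by rewrite invr_ge0 sqr_ge0.
exists (8 * V0 ^- 2); first by rewrite mulr_ge0.
move=> v s x Vv s0; have v0 : 0 < v := lt_le_trans V00 Vv.
have bd w : v <= w ->
    `|w ^- 2 * ((3 / 2 * z w x - z w x ^+ 3 / 2) * phi (z w x))| <= 8 * V0 ^- 2.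
  move=> vw; have w0 : 0 < w := lt_le_trans v0 vw.
  have iw : w ^- 2 <= V0 ^- 2.
    rewrite lef_pV2 ?posrE ?exprn_gt0 // lerXn2r ?nnegrE ?(ltW V00) ?(ltW w0) //.
    exact: le_trans Vv vw.
  have iw0 : 0 <= w ^- 2 by rewrite invr_ge0 sqr_ge0.
  rewrite normrM (ger0_norm iw0) mulrC; apply: ler_pM => //.
  have [_ h1 _ h2] := phi_bounds (z w x); have f0 := phi_ge0 (z w x).
  rewrite normrM (ger0_norm f0).
  have : `|3 / 2 * z w x - z w x ^+ 3 / 2| <= 3 / 2 * `|z w x| + `|z w x| ^+ 3 / 2.
    apply: le_trans (ler_normB _ _) _; move: (z w x) => u.
    rewrite normrM (ger0_norm (_ : 0 <= 3 / 2 :> R)) // lerD2l -normrX.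
    by rewrite normrM (ger0_norm (_ : 0 <= 2^-1 :> R)).
  by move=> /(ler_wpM2r f0) /le_trans; apply; lra.
have mvt (f f' : R -> R) : (forall u : R, 0 < u -> is_derive u (1 : R) f (f' u)) ->
    forall w, v <= w -> exists2 c, v <= c <= w & f w - f v = f' c * (w - v).
  move=> df w vw.
  have [||c] := MVT_segment (f := f) (df := f') vw.
  - by move=> u; rewrite in_itv /= => /andP[vu _]; apply: df; exact: lt_trans vu.
  - apply: continuous_in_subspaceT => u; rewrite inE /= in_itv /= => /andP[vu _].
    apply/differentiable_continuous/derivable1_diffP.
    by have [] := df _ (lt_le_trans v0 vu).
  - by rewrite in_itv /= => hc ->; exists c.
have vs : v <= v + s by rewrite lerDl.
have [c /andP[vc cs] ->] :=
  mvt (smooth_cdf ^~ x) _ (fun u u0 => is_derive_smooth_cdf_var x u0) _ vs.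
have [c' /andP[vc' cc'] e] :=
  mvt (smooth_cdf2 ^~ x) _ (fun u u0 => is_derive_smooth_cdf2_var x u0) _ vc.
have -> : 2^-1 * smooth_cdf2 c x * (v + s - v) - s / 2 * smooth_cdf2 v x
    = s / 2 * (smooth_cdf2 c x - smooth_cdf2 v x) by ring.
rewrite e normrM (ger0_norm (_ : 0 <= s / 2)) ?divr_ge0 //.
rewrite [X in _ * X]normrM.
have hb := bd c' vc'.
rewrite (ger0_norm (_ : 0 <= c - v)) ?subr_ge0 //.
have c1 : c - v <= s by lra.
set B := `|_ * _| in hb *.
have B0 : 0 <= B := normr_ge0 _.
have : B * (c - v) <= 8 * V0 ^- 2 * s by apply: ler_pM => //; rewrite subr_ge0.
move: (8 * V0 ^- 2) => K hK.
have : s * (B * (c - v)) <= s * (K * s) by rewrite ler_wpM2l.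
have : 0 <= B * (c - v) by rewrite mulr_ge0 // subr_ge0.
move=> h1; have := mulr_ge0 s0 h1; lra.
Qed.

End HeatSolution.
End NormalCdf.

(** * Moments of the noise *)

Section Integrals.
Context (R : realType) (d : measure_display) (T : measurableType d).
Variable P : probability T R.
Implicit Types f g : T -> R.

Definition L1 f := P.-integrable [set: T] (EFin \o f).

Lemma L1_measurable f : L1 f -> measurable_fun setT f.
Proof. by move=> /integrableP[/measurable_EFinP]. Qed.

Lemma L1D f g : L1 f -> L1 g -> L1 (fun w => f w + g w).
Proof. by move=> hf hg; exact: (integrableD measurableT hf hg). Qed.

Lemma L1Z c f : L1 f -> L1 (fun w => c * f w).
Proof. by move=> hf; exact: (integrableZl measurableT c hf). Qed.

Lemma L1B f g : L1 f -> L1 g -> L1 (fun w => f w - g w).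
Proof. by move=> hf hg; exact: (integrableB measurableT hf hg). Qed.

Lemma L1_cst c : L1 (fun=> c).
Proof. exact: finite_measure_integrable_cst. Qed.

Lemma L1_le f g : measurable_fun setT f -> (forall w, `|f w| <= g w) -> L1 g -> L1 f.
Proof.
move=> mf fg hg; apply: (le_integrable measurableT _ _ hg).
  exact/measurable_EFinP.
by move=> w _ /=; rewrite lee_fin (le_trans (fg w)) // ler_norm.
Qed.

Lemma L1_bounded f c : measurable_fun setT f -> (forall w, `|f w| <= c) -> L1 f.
Proof. by move=> mf fc; exact: L1_le mf fc (L1_cst c). Qed.

Lemma L1_finite f : measurable_fun setT f -> (forall w, 0 <= f w) ->
  (\int[P]_w (f w)%:E < +oo)%E -> L1 f.
Proof.
move=> mf f0 h; apply/integrableP; split; first exact/measurable_EFinP.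
by under eq_integral do rewrite /= ger0_norm ?f0 //.
Qed.

Lemma Rintegral_prob_cst c : \int[P]_w c = c.
Proof. by rewrite Rintegral_cst //= (@probability_setT _ _ _ P) mulr1. Qed.

Lemma EFin_Rintegral f : L1 f -> (\int[P]_w f w)%:E = (\int[P]_w (f w)%:E)%E.
Proof. by move=> hf; rewrite /Rintegral fineK //; exact: integrable_fin_num. Qed.

Lemma Rintegral_abs_le f g : L1 f -> L1 g -> (forall w, `|f w| <= g w) ->
  `|\int[P]_w f w| <= \int[P]_w g w.
Proof.
move=> hf hg fg; apply: le_trans (le_normr_Rintegral measurableT hf) _.
apply: le_Rintegral => //; apply: (@L1_le _ g) => //.
  by apply: measurableT_comp => //; exact: L1_measurable.
by move=> w; rewrite normr_id.
Qed.

End Integrals.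

Section SquareIntegrableNoise.
Context (R : realType) (d : measure_display) (T : measurableType d).
Variable P : probability T R.
Variables (eps : nat -> {RV P >-> R}) (sigma : R).
Hypothesis Hmean : forall i, 'E_P[eps i]%E = 0%E.
Hypothesis Hvar : forall i, 'V_P[eps i]%E = (sigma ^+ 2)%:E.

Notation L1 := (L1 P).

Let second_moment i : (\int[P]_w (eps i w ^+ 2)%:E = (sigma ^+ 2)%:E)%E.
Proof.
rewrite -(Hvar i) /variance unlock Hmean /= unlock.
by apply: eq_integral => w _ /=; rewrite /GRing.mul /= !subr0 -expr2.
Qed.

Lemma noise_sqr_L1 i : L1 (fun w => eps i w ^+ 2).
Proof.
apply: L1_finite => [|w|]; first exact: measurable_funX.
- exact: sqr_ge0.
- by rewrite second_moment ltry.
Qed.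

(** Integrability comes from the finite second moment, by [|x| <= 1 + x ^+ 2]. *)
Lemma noise_L1 i : L1 (eps i).
Proof.
apply: (@L1_le _ _ _ _ _ (fun w => 1 + eps i w ^+ 2)) => [//|w|].
  have h : 0 <= (1 - `|eps i w|) ^+ 2 by exact: sqr_ge0.
  have h2 : `|eps i w| ^+ 2 = eps i w ^+ 2 by rewrite real_normK ?num_real.
  have := normr_ge0 (eps i w); move: h; rewrite -h2; move: `|_| => a; lra.
by apply: L1D; [exact: L1_cst|exact: noise_sqr_L1].
Qed.

Lemma noise_mean i : \int[P]_w eps i w = 0.
Proof. by have := Hmean i; rewrite unlock /Rintegral => ->. Qed.

Lemma noise_second_moment i : \int[P]_w eps i w ^+ 2 = sigma ^+ 2.
Proof. by rewrite /Rintegral second_moment. Qed.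

Lemma integral_affine_sqr i x c :
  \int[P]_w (x + c * eps i w) ^+ 2 = x ^+ 2 + c ^+ 2 * sigma ^+ 2
  /\ L1 (fun w => (x + c * eps i w) ^+ 2).
Proof.
have e : (fun w => (x + c * eps i w) ^+ 2)
    = (fun w => x ^+ 2 + (2 * x * c * eps i w + c ^+ 2 * eps i w ^+ 2)).
  by apply/funext => w; ring.
have h1 := noise_L1 i; have h2 := noise_sqr_L1 i.
have i1 : L1 (fun w => 2 * x * c * eps i w) by exact: L1Z.
have i2 : L1 (fun w => c ^+ 2 * eps i w ^+ 2) by exact: L1Z.
rewrite e; split; last by apply: L1D; [exact: L1_cst|exact: L1D].
rewrite RintegralD //; [|exact: L1_cst|exact: L1D].
rewrite RintegralD // Rintegral_prob_cst !RintegralZl //.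
by rewrite noise_mean noise_second_moment mulr0 add0r.
Qed.

Hypothesis indep : independent_RVs eps.

(** One variable at a time: by Tonelli, the last variable can be integrated first,
    and its mean 0 removes the cross term. *)
Lemma lin_comb_second_moment (c : nat -> R) n :
  (\int[P]_w ((\sum_(j < n) c j * eps j w) ^+ 2)%:E
    = (sigma ^+ 2 * \sum_(j < n) c j ^+ 2)%:E)%E.
Proof.
elim: n => [|n IH].
  under eq_integral do rewrite big_ord0 expr0n /=.
  by rewrite integral0 big_ord0 mulr0.
under eq_integral do rewrite big_ord_recr /=.
pose F (z : R * R) : \bar R := ((z.1 + c n * z.2) ^+ 2)%:E.
have mF : measurable_fun setT F.
  apply/measurable_EFinP; apply: measurable_funX; apply: measurable_funD => //.
  exact: measurable_funM.
have F0 z : (0 <= F z)%E by rewrite lee_fin sqr_ge0.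
rewrite (integral_independent_pair (measurable_lin_comb eps c n) _
  (lin_comb_independent indep c n) mF F0) //.
rewrite (eq_integral (fun w => ((\sum_(j < n) c j * eps j w) ^+ 2)%:E
    + (c n ^+ 2 * sigma ^+ 2)%:E)%E); last first.
  move=> w _; rewrite /F /=.
  have [e h] := integral_affine_sqr n (\sum_(j < n) c j * eps j w) (c n).
  by rewrite -EFinD -e EFin_Rintegral.
rewrite ge0_integralD //; last 3 first.
- by move=> w _; rewrite lee_fin sqr_ge0.
- by apply/measurable_EFinP; apply: measurable_funX; exact: measurable_lin_comb.
- by move=> w _; rewrite lee_fin mulr_ge0 ?sqr_ge0.
rewrite IH integral_cst //= (@probability_setT _ _ _ P) mule1 -EFinD big_ord_recr /=.
by congr EFin; ring.
Qed.

(** The integrand of the Lindeberg condition. *)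
Definition noise_tail i (M : R) (w : T) : R := eps i w ^+ 2 * (M < `|eps i w|)%R%:R.

Let measurable_truncated_sqr (M : R) :
  measurable_fun setT (fun x : R => x ^+ 2 * (M < `|x|)%R%:R).
Proof.
apply: measurable_funM; first exact: measurable_funX.
have -> : (fun x : R => (M < `|x|)%R%:R) = \1_((@Num.norm R R) @^-1` `]M, +oo[) :> (R -> R).
  apply/funext => x; rewrite indicE; congr (nat_of_bool _)%:R;
    by apply/idP/idP; rewrite inE /= in_itv /= andbT.
apply: measurable_indic; rewrite -[X in measurable X]setTI.
exact: normr_measurable.
Qed.

Lemma measurable_tail i M : measurable_fun setT (noise_tail i M).
Proof. exact: (measurableT_comp (measurable_truncated_sqr M)). Qed.

Lemma tail_ge0 i M w : 0 <= noise_tail i M w.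
Proof. by rewrite mulr_ge0 ?sqr_ge0. Qed.

Lemma tail_le i M w : noise_tail i M w <= eps i w ^+ 2.
Proof. by rewrite ler_piMr ?sqr_ge0 // lern1 leq_b1. Qed.

Lemma tail_L1 i M : L1 (noise_tail i M).
Proof.
apply: L1_le (measurable_tail i M) _ (noise_sqr_L1 i) => w.
by rewrite ger0_norm ?tail_ge0 ?tail_le.
Qed.

Hypothesis ident : identically_distributed eps.

Lemma tail_ident i M : \int[P]_w noise_tail i M w = \int[P]_w noise_tail 0%N M w.
Proof.
congr fine; pose g (x : R) : \bar R := (x ^+ 2 * (M < `|x|)%R%:R)%:E.
have mg : measurable_fun setT g by apply/measurable_EFinP.
have g0 x : (0 <= g x)%E by rewrite lee_fin mulr_ge0 ?sqr_ge0.
have ge j : (\int[P]_w (noise_tail j M w)%:E = \int[distribution P (eps j)]_x g x)%E.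
  by rewrite (ge0_integral_distribution (eps j)).
rewrite !ge; apply: eq_measure_integral => A mA _; exact: ident.
Qed.

Lemma tail_small (e : R) : 0 < e -> exists2 M, 0 < M & \int[P]_w noise_tail 0%N M w <= e.
Proof.
move=> e0.
have [|||||_ _] := @dominated_convergence _ T R P setT measurableT
  (fun n w => (noise_tail 0%N n%:R w)%:E) (cst 0%E) (fun w => (eps 0%N w ^+ 2)%:E).
- by move=> n; apply/measurable_EFinP; exact: measurable_tail.
- exact: measurable_cst.
- apply: aeW => w _; apply: cvg_near_cst.
  have [N _ hN] := nbhs_infty_ger `|eps 0%N w|.
  exists N => // n /hN /= h; rewrite /noise_tail ltNge h mulr0 //.
- exact: noise_sqr_L1.
- apply: aeW => w n _ /=; rewrite lee_fin ger0_norm ?tail_ge0 ?tail_le //.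
rewrite integral0 => /fine_cvgP[_ /cvgrPdist_le /(_ e e0)].
move=> [N _ hN]; exists N.+1%:R => //.
have := hN N.+1 (leqnSn N) => /=.
rewrite sub0r normrN; apply: le_trans; exact: ler_norm.
Qed.

End SquareIntegrableNoise.

(** * Lindeberg's replacement argument *)

Section Lindeberg.
Context (R : realType) (d : measure_display) (T : measurableType d).
Variable P : probability T R.
Variables (eps : nat -> {RV P >-> R}) (sigma : R).
Hypothesis Hmean : forall i, 'E_P[eps i]%E = 0%E.
Hypothesis Hvar : forall i, 'V_P[eps i]%E = (sigma ^+ 2)%:E.
Hypothesis indep : independent_RVs eps.
Hypothesis ident : identically_distributed eps.
Variable t : R.

Notation L1 := (L1 P).
Notation noise_tail := (noise_tail eps).

Lemma smooth_cdf_bounds v (x : R) : `|smooth_cdf t v x| <= 1.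
Proof. by rewrite ger0_norm ?Phi_ge0 ?Phi_le1. Qed.

Lemma measurable_smooth_cdf v : measurable_fun setT (smooth_cdf t v).
Proof.
apply: continuous_measurable_fun => x.
apply/differentiable_continuous/derivable1_diffP.
by have [] := is_derive_smooth_cdf t v x.
Qed.

Lemma smooth_cdf_L1 v (X : T -> R) : measurable_fun setT X ->
  L1 (fun w => smooth_cdf t v (X w)).
Proof.
move=> mX; apply: (@L1_bounded _ _ _ _ _ 1).
  by apply: measurableT_comp mX; exact: measurable_smooth_cdf.
by move=> w; exact: smooth_cdf_bounds.
Qed.

Section Step.
Variables (V0 K Kheat M delta : R).
Hypotheses (K_ge0 : 0 <= K) (delta_ge0 : 0 <= delta).
Hypothesis taylor : forall v x y, V0 <= v ->
  `|smooth_cdf t v (x + y) - smooth_cdf t v x - smooth_cdf1 t v x * y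
    - smooth_cdf2 t v x * y ^+ 2 / 2| <= K * `|y| ^+ 3
  /\ `|smooth_cdf t v (x + y) - smooth_cdf t v x - smooth_cdf1 t v x * y
        - smooth_cdf2 t v x * y ^+ 2 / 2| <= K * `|y| ^+ 2.
Hypothesis heat : forall v s x, V0 <= v -> 0 <= s ->
  `|smooth_cdf t (v + s) x - smooth_cdf t v x - s / 2 * smooth_cdf2 t v x|
    <= Kheat * s ^+ 2.

Definition step_error (c : R) : R :=
  K * c ^+ 2 * (delta * sigma ^+ 2 + \int[P]_w noise_tail 0%N M w)
  + Kheat * (c ^+ 2 * sigma ^+ 2) ^+ 2.

(** Replacing one noise variable by an increase of the variance: the first two
    moments match by the heat equation, and the Taylor remainder is cubic for
    small values of the noise and quadratic on the tail. *)
Lemma smoothing_step i V c x : V0 <= V -> `|c| * M <= delta ->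
  `|\int[P]_w smooth_cdf t V (x + c * eps i w)
    - smooth_cdf t (V + c ^+ 2 * sigma ^+ 2) x| <= step_error c.
Proof.
move=> VV cM.
set g := smooth_cdf t V; set g1 := smooth_cdf1 t V x; set g2 := smooth_cdf2 t V x.
pose r w := g (x + c * eps i w) - g x - g1 * (c * eps i w)
              - g2 * (c * eps i w) ^+ 2 / 2.
pose q w := g x + (g1 * c * eps i w + g2 * c ^+ 2 / 2 * eps i w ^+ 2).
have h1 := noise_L1 Hmean Hvar i; have h2 := noise_sqr_L1 Hmean Hvar i.
have mx : measurable_fun setT (fun w => x + c * eps i w).
  by apply: measurable_funD => //; exact: measurable_funM.
have hg : L1 (fun w => g (x + c * eps i w)) by exact: smooth_cdf_L1.
have i1 : L1 (fun w => g1 * c * eps i w) by exact: L1Z.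
have i2 : L1 (fun w => g2 * c ^+ 2 / 2 * eps i w ^+ 2) by exact: L1Z.
have hq : L1 q by apply: L1D; [exact: L1_cst|exact: L1D].
have rE : r = (fun w => g (x + c * eps i w) - q w).
  by apply/funext => w; rewrite /r /q; field.
have hr : L1 r by rewrite rE; exact: L1B.
have intq : \int[P]_w q w = g x + g2 * c ^+ 2 / 2 * sigma ^+ 2.
  rewrite RintegralD //; [|exact: L1_cst|exact: L1D].
  rewrite RintegralD // Rintegral_prob_cst !RintegralZl //.
  by rewrite noise_mean // (noise_second_moment Hmean Hvar) mulr0 add0r.
have intr : \int[P]_w g (x + c * eps i w)
    = \int[P]_w r w + (g x + g2 * c ^+ 2 / 2 * sigma ^+ 2).
  by rewrite rE RintegralB // intq subrK.
pose b w := K * c ^+ 2 * (delta * eps i w ^+ 2 + noise_tail i M w).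
have hb : L1 b.
  by apply: L1Z; apply: L1D; [exact: L1Z|exact: (tail_L1 Hmean Hvar)].
have rb w : `|r w| <= b w.
  have [r3 r2] := taylor x (c * eps i w) VV; rewrite -/g -/g1 -/g2 -/(r w) in r3 r2.
  have y2 : `|c * eps i w| ^+ 2 = c ^+ 2 * eps i w ^+ 2.
    by rewrite real_normK ?num_real // exprMn.
  have c2 : 0 <= K * c ^+ 2 * eps i w ^+ 2 by rewrite mulr_ge0 ?sqr_ge0 // mulr_ge0 ?sqr_ge0.
  rewrite /b /noise_tail; case: (ltP M `|eps i w|) => /= hM.
    rewrite y2 in r2; rewrite mulr1 (le_trans r2) //.
    have : 0 <= delta * (K * c ^+ 2 * eps i w ^+ 2) by rewrite mulr_ge0.
    lra.
  have hd : `|c * eps i w| <= delta.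
    by rewrite normrM (le_trans _ cM) // ler_wpM2l.
  rewrite mulr0 addr0 (le_trans r3) // exprS y2.
  have : `|c * eps i w| * (K * c ^+ 2 * eps i w ^+ 2)
      <= delta * (K * c ^+ 2 * eps i w ^+ 2) by rewrite ler_wpM2r.
  lra.
have intb : \int[P]_w b w = K * c ^+ 2 * (delta * sigma ^+ 2 + \int[P]_w noise_tail 0%N M w).
  have t1 : L1 (noise_tail i M) by exact: (tail_L1 Hmean Hvar).
  have t2 : L1 (fun w => delta * eps i w ^+ 2) by exact: L1Z.
  rewrite RintegralZl //; last exact: L1D.
  by rewrite RintegralD // RintegralZl // (noise_second_moment Hmean Hvar) tail_ident.
have s0 : 0 <= c ^+ 2 * sigma ^+ 2 by rewrite mulr_ge0 ?sqr_ge0.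
have hh := heat x VV s0; rewrite -/g2 in hh.
have hrb := Rintegral_abs_le hr hb rb; rewrite intb in hrb.
rewrite intr /step_error; move: hh hrb; rewrite distrC.
set I := \int[P]_w r w; set J := smooth_cdf t (_ + _) x; set A := _ * (_ + _).
set B := Kheat * _; set s := c ^+ 2 * sigma ^+ 2.
have -> : I + (g x + g2 * c ^+ 2 / 2 * sigma ^+ 2) - J
    = I + (s / 2 * g2 - (J - g x)) by rewrite /s; ring.
move=> hh hrb; rewrite (le_trans (ler_normD _ _)) // lerD //.
Qed.

(** The preceding bound is uniform in [x], so it can be integrated over the law of
    the partial sum, which is independent of the variable replaced. *)
Lemma lindeberg_step (c : nat -> R) n V : V0 <= V -> `|c n| * M <= delta ->
  `|\int[P]_w smooth_cdf t V (\sum_(j < n.+1) c j * eps j w)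
    - \int[P]_w smooth_cdf t (V + c n ^+ 2 * sigma ^+ 2) (\sum_(j < n) c j * eps j w)|
  <= step_error (c n).
Proof.
move=> VV cM; set S := fun w => \sum_(j < n) c j * eps j w.
have mS : measurable_fun setT S := measurable_lin_comb eps c n.
pose G x := \int[P]_w smooth_cdf t V (x + c n * eps n w).
have hx x : L1 (fun w => smooth_cdf t V (x + c n * eps n w)).
  by apply: smooth_cdf_L1; apply: measurable_funD => //; exact: measurable_funM.
pose F (z : R * T) : \bar R := (smooth_cdf t V (z.1 + c n * eps n z.2))%:E.
have mF : measurable_fun setT F.
  apply/measurable_EFinP; apply: (measurableT_comp (measurable_smooth_cdf V)).
  apply: measurable_funD => //; apply: measurable_funM => //.
  exact: measurableT_comp.
have F0 z : (0 <= F z)%E by rewrite lee_fin Phi_ge0.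
have GE x : (G x)%:E = (\int[P]_w F (x, w))%E by rewrite EFin_Rintegral.
have mG : measurable_fun setT G.
  apply/measurable_EFinP.
  have -> : EFin \o G = fun x => (\int[P]_w F (x, w))%E by apply/funext.
  exact: (measurable_fun_fubini_tonelli_F (m2 := P) F mF F0).
have G01 x : `|G x| <= 1.
  rewrite -(Rintegral_prob_cst P 1); apply: Rintegral_abs_le => //.
    exact: L1_cst.
  by move=> w; exact: smooth_cdf_bounds.
have hG : L1 (G \o S).
  apply: (@L1_bounded _ _ _ _ _ 1) => [|w]; last exact: G01.
  exact: measurableT_comp.
have -> : \int[P]_w smooth_cdf t V (\sum_(j < n.+1) c j * eps j w) = \int[P]_w G (S w).
  congr fine; under eq_integral do rewrite big_ord_recr /=.
  pose F2 (z : R * R) : \bar R := (smooth_cdf t V (z.1 + c n * z.2))%:E.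
  have mF2 : measurable_fun setT F2.
    apply/measurable_EFinP; apply: (measurableT_comp (measurable_smooth_cdf V)).
    by apply: measurable_funD => //; exact: measurable_funM.
  have F20 z : (0 <= F2 z)%E by rewrite lee_fin Phi_ge0.
  rewrite (integral_independent_pair (measurable_lin_comb eps c n) _
    (lin_comb_independent indep c n) mF2 F20) //.
  by apply: eq_integral => w _; rewrite GE.
have hg : L1 (fun w => smooth_cdf t (V + c n ^+ 2 * sigma ^+ 2) (S w)).
  exact: smooth_cdf_L1.
rewrite -RintegralB // -[leRHS](Rintegral_prob_cst P).
apply: Rintegral_abs_le; [exact: L1B|exact: L1_cst|].
by move=> w; exact: smoothing_step.
Qed.

(** The last variable is replaced first: the initial variance [V] has to be
    arbitrary for the induction, while the error only depends on the lower bound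
    [V0]. *)
Lemma lindeberg_telescope (c : nat -> R) n V : V0 <= V ->
  (forall j, (j < n)%N -> `|c j| * M <= delta) ->
  `|\int[P]_w smooth_cdf t V (\sum_(j < n) c j * eps j w)
    - smooth_cdf t (V + sigma ^+ 2 * \sum_(j < n) c j ^+ 2) 0|
  <= \sum_(j < n) step_error (c j).
Proof.
elim: n V => [|n IH] V VV cM.
  under eq_Rintegral do rewrite big_ord0.
  by rewrite Rintegral_prob_cst !big_ord0 mulr0 addr0 subrr normr0.
rewrite [leRHS]big_ord_recr /= addrC.
apply: le_trans (ler_distD (\int[P]_w smooth_cdf t (V + c n ^+ 2 * sigma ^+ 2)
  (\sum_(j < n) c j * eps j w)) _ _) _.
apply: lerD; first by apply: lindeberg_step => //; exact: cM.
have -> : V + sigma ^+ 2 * \sum_(j < n.+1) c j ^+ 2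
   = V + c n ^+ 2 * sigma ^+ 2 + sigma ^+ 2 * \sum_(j < n) c j ^+ 2.
  by rewrite big_ord_recr /=; ring.
apply: IH => [|j jn]; last by apply: cM; exact: ltnW.
by rewrite (le_trans VV) // lerDl mulr_ge0 ?sqr_ge0.
Qed.

End Step.

(** Each step error is at most [e] times the share of the variance carried by the
    variable replaced, and these shares sum to 1. *)
Lemma smoothed_clt (V0 e : R) : 0 < V0 -> 0 < e -> 0 < sigma ->
  exists2 mu, 0 < mu & forall (c : nat -> R) n,
    sigma ^+ 2 * \sum_(j < n) c j ^+ 2 = 1 ->
    (forall j, (j < n)%N -> `|c j| <= mu) ->
    `|\int[P]_w smooth_cdf t V0 (\sum_(j < n) c j * eps j w)
      - smooth_cdf t (V0 + 1) 0| <= e.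
Proof.
move=> V00 e0 s0; have s20 : 0 < sigma ^+ 2 by rewrite exprn_gt0.
have [K K0 hK] := smooth_cdf_taylor t V00.
have [Kh Kh0 hKh] := smooth_cdf_heat t V00.
have K1 : 0 < K + 1 by lra.
have [|M M0 hM] := tail_small Hmean Hvar (e := e * sigma ^+ 2 / (3 * (K + 1))).
  by rewrite divr_gt0 ?mulr_gt0.
pose delta := e / (3 * (K + 1)).
have d0 : 0 < delta by rewrite divr_gt0 // mulr_gt0.
pose mu := Num.min (delta / M) (Num.min 1 (e / (3 * (Kh * sigma ^+ 2 + 1)))).
have H0 : 0 < Kh * sigma ^+ 2 + 1.
  by rewrite ltr_wpDl // mulr_ge0 // ltW.
have mu0 : 0 < mu by rewrite !lt_min divr_gt0 //= ltr01 divr_gt0 // mulr_gt0.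
exists mu => // c n c1 cmu.
have cM j : (j < n)%N -> `|c j| * M <= delta.
  move=> /cmu h; rewrite -ler_pdivlMr // (le_trans h) // /mu ge_min lexx //.
have := lindeberg_telescope K0 (ltW d0) hK hKh (lexx V0) cM.
rewrite c1 => /le_trans; apply.
set tau := \int[P]_w _ in hM.
have Kd : K * delta <= e / 3.
  have -> : e / 3 = (K + 1) * delta by rewrite /delta; field; rewrite gt_eqF.
  by rewrite ler_wpM2r ?(ltW d0) //; lra.
have Kt : K * tau <= sigma ^+ 2 * (e / 3).
  have -> : sigma ^+ 2 * (e / 3) = (K + 1) * (e * sigma ^+ 2 / (3 * (K + 1))).
    by field; rewrite gt_eqF.
  have t0 : 0 <= tau by apply: Rintegral_ge0 => w _; exact: tail_ge0.
  by apply: ler_pM => //; lra.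
have small j : (j < n)%N -> Kh * sigma ^+ 2 * c j ^+ 2 <= e / 3.
  move=> jn; have cj := cmu j jn.
  have cj1 : `|c j| <= 1 by rewrite (le_trans cj) // /mu !ge_min lexx !orbT.
  have cj2 : `|c j| <= e / (3 * (Kh * sigma ^+ 2 + 1)).
    by rewrite (le_trans cj) // /mu !ge_min lexx !orbT.
  have -> : e / 3 = (Kh * sigma ^+ 2 + 1) * (e / (3 * (Kh * sigma ^+ 2 + 1))).
    by field; rewrite gt_eqF.
  apply: ler_pM; rewrite ?sqr_ge0 //.
  - by rewrite mulr_ge0 // ltW.
  - by lra.
  rewrite (le_trans _ cj2) // -real_normK ?num_real // expr2.
  by rewrite ler_piMl.
have step j : (j < n)%N -> step_error K Kh M delta (c j) <= e * (sigma ^+ 2 * c j ^+ 2).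
  move=> jn; rewrite /step_error -/tau.
  have c0 : 0 <= c j ^+ 2 := sqr_ge0 _.
  have h1 := ler_wpM2l c0 Kt.
  have sc0 : 0 <= c j ^+ 2 * sigma ^+ 2 by rewrite mulr_ge0 // ltW.
  have h2 := ler_wpM2l sc0 Kd.
  have h3 := ler_wpM2l sc0 (small j jn).
  lra.
rewrite -[leRHS]mulr1 -c1 !mulr_sumr; apply: ler_sum => j _.
exact: step.
Qed.

End Lindeberg.

(** * Convergence of distribution functions *)

Section Slutsky.
Context (R : realType) (d : measure_display) (T : measurableType d).
Variable P : probability T R.

Lemma measurable_sublevel (f : T -> R) t :
  measurable_fun setT f -> measurable [set w | f w <= t].
Proof.
move=> mf; have -> : [set w | f w <= t] = setT `&` f @^-1` [set` `]-oo, t]].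
  by rewrite setTI; apply/seteqP; split=> w; rewrite /= in_itv.
exact: mf measurableT _ (measurable_itv _).
Qed.

Lemma measurable_superlevel (f : T -> R) t :
  measurable_fun setT f -> measurable [set w | t < f w].
Proof.
move=> mf; have -> : [set w | t < f w] = setT `&` f @^-1` [set` `]t, +oo[].
  by rewrite setTI; apply/seteqP; split=> w; rewrite /= in_itv /= andbT.
exact: mf measurableT _ (measurable_itv _).
Qed.

Lemma Rintegral_indic (E : set T) : measurable E -> \int[P]_w (\1_E w : R) = fine (P E).
Proof. by move=> mE; rewrite /Rintegral integral_indic // setIT. Qed.

Lemma L1_indic (E : set T) : measurable E -> L1 P (\1_E : T -> R).
Proof.
move=> mE; apply: (@L1_bounded _ _ _ _ _ 1); first exact: measurable_indic.
by move=> w; rewrite indicE; case: (_ \in _); rewrite ?normr1 ?normr0.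
Qed.

Lemma Phi_near (t e : R) : 0 < e ->
  exists2 r, 0 < r & forall y, `|y - t| < r -> `|Phi y - Phi t| <= e.
Proof.
move=> e0; have ct : {for t, continuous (@Phi R)}.
  apply/differentiable_continuous/derivable1_diffP.
  by have [] := is_derive_Phi t.
have /cvgrPdist_le /(_ e e0) /nbhs_ballP [r r0 hr] := ct.
exists r => // y hy; rewrite distrC; apply: hr.
by rewrite /ball /= distrC.
Qed.

(** The indicator of [A <= t] is squeezed between smoothed distribution
    functions of [S] at levels shifted by twice the tolerance, up to the tails of
    the smoothing law. *)
Lemma squeeze_cdf (A S : T -> R) (t delta V0 kappa : R) :
  measurable_fun setT A -> measurable_fun setT S ->
  0 < V0 -> 0 < delta ->
  1 - Phi (delta / Num.sqrt V0) <= kappa -> Phi (- (delta / Num.sqrt V0)) <= kappa ->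
  fine (P [set w | A w <= t])
    <= \int[P]_w smooth_cdf (t + 2 * delta) V0 (S w)
       + (kappa + fine (P [set w | delta < `|A w - S w|]))
  /\ \int[P]_w smooth_cdf (t - 2 * delta) V0 (S w)
    <= fine (P [set w | A w <= t])
       + (kappa + fine (P [set w | delta < `|A w - S w|])).
Proof.
move=> mA mS V00 d0 k1 k2.
have sV : 0 < Num.sqrt V0 by rewrite sqrtr_gt0.
have kappa0 : 0 <= kappa by apply: le_trans k2; exact: Phi_ge0.
have mE1 : measurable [set w | A w <= t] by exact: measurable_sublevel.
have mE2 : measurable [set w | delta < `|A w - S w|].
  by apply: measurable_superlevel; apply: measurableT_comp => //; exact: measurable_funB.
set E1 := [set w | _] in mE1 *; set E2 := [set w | _] in mE2 *.
have i1 := L1_indic mE1; have i2 := L1_indic mE2.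
have ig u : L1 P (fun w => smooth_cdf u V0 (S w)) by exact: smooth_cdf_L1.
have ik : L1 P (fun=> kappa) := L1_cst P kappa.
rewrite -!Rintegral_indic // -(Rintegral_prob_cst P kappa).
have ind (E : set T) w : (\1_E w : R) = (w \in E)%:R by rewrite indicE.
have in1 w : (w \in E1) = (A w <= t) by apply/idP/idP; rewrite inE.
have in2 w : (w \in E2) = (delta < `|A w - S w|) by apply/idP/idP; rewrite inE.
split; rewrite -!RintegralD //; try (by do ?apply: L1D); try exact: ig.
  apply: le_Rintegral => //; first by do ?apply: L1D.
  move=> w _; rewrite !ind in1 in2.
  have g0 := Phi_ge0 ((t + 2 * delta - S w) / Num.sqrt V0).
  rewrite /smooth_cdf; case: (leP (A w) t) => hA /=;
    last by case: (ltP delta `|A w - S w|) => _ /=; lra.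
  case: (ltP delta `|A w - S w|) => hD /=; first by lra.
  have : Phi (delta / Num.sqrt V0) <= Phi ((t + 2 * delta - S w) / Num.sqrt V0).
    apply: Phi_homo; rewrite ler_pM2r ?invr_gt0 //.
    by move: hD; rewrite ler_norml => /andP[]; lra.
  by lra.
apply: le_Rintegral => //; [exact: ig|by do ?apply: L1D|].
move=> w _; rewrite !ind in1 in2.
have g1 := Phi_le1 ((t - 2 * delta - S w) / Num.sqrt V0).
rewrite /smooth_cdf; case: (leP (A w) t) => hA /=;
  first by case: (ltP delta `|A w - S w|) => _ /=; lra.
case: (ltP delta `|A w - S w|) => hD /=; first by lra.
have : Phi ((t - 2 * delta - S w) / Num.sqrt V0) <= Phi (- (delta / Num.sqrt V0)).
  apply: Phi_homo; rewrite -[leRHS]mulNr ler_pM2r ?invr_gt0 //.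
  by move: hD; rewrite ler_norml => /andP[]; lra.
by lra.
Qed.

Variables (eps : nat -> {RV P >-> R}) (sigma : R).
Hypothesis Hmean : forall i, 'E_P[eps i]%E = 0%E.
Hypothesis Hvar : forall i, 'V_P[eps i]%E = (sigma ^+ 2)%:E.
Hypothesis indep : independent_RVs eps.
Hypothesis ident : identically_distributed eps.
Hypothesis sigma_gt0 : 0 < sigma.

(** The tolerance [delta] and the smoothing variance tend to 0 together, with
    [sqrt V0] equal to [delta / M'] for a fixed large [M'], so that the tails of
    the smoothing law beyond [delta] stay small. *)
Lemma clt_slutsky (c : nat -> nat -> R) (A : nat -> T -> R) (t : R) :
  (\forall n \near \oo, measurable_fun setT (A n)) ->
  (\forall n \near \oo, sigma ^+ 2 * \sum_(j < n) c n j ^+ 2 = 1) ->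
  (forall mu, 0 < mu -> \forall n \near \oo, forall j, (j < n)%N -> `|c n j| <= mu) ->
  (forall delta, 0 < delta -> (fun n => fine (P [set w |
     delta < `|A n w - \sum_(j < n) c n j * eps j w|])) @ \oo --> (0 : R)) ->
  (fun n => fine (P [set w | A n w <= t])) @ \oo --> Phi t.
Proof.
move=> mA c1 cmax rem; apply/cvgrPdist_le => e e0.
have e4 : 0 < e / 4 by rewrite divr_gt0.
have budget (p f i1 i2 g1 g2 q : R) :
    p <= i1 + (e / 4 + q) -> i2 <= p + (e / 4 + q) -> q <= e / 4 ->
    i1 - g1 <= e / 4 -> - (e / 4) <= i2 - g2 ->
    g1 - f <= e / 4 -> - (e / 4) <= g2 - f -> - e <= f - p <= e.
  by move=> *; apply/andP; split; lra.
have [r r0 hr] := Phi_near t e4.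
have [M M0 hM] := Phi_tails e4.
pose M' := M + 1; have M'1 : 1 <= M' by rewrite lerDr ltW.
have MM' : M <= M' by rewrite lerDl.
pose delta := Num.min 1 (r / (2 * (`|t| + 2))).
have t2 : 0 < `|t| + 2 by rewrite ltr_wpDl.
have d0 : 0 < delta by rewrite lt_min ltr01 divr_gt0 // mulr_gt0.
have d1 : delta <= 1 by rewrite ge_min lexx.
have dr : (`|t| + 2) * delta < r.
  apply: (@le_lt_trans _ _ (r / 2)); last by lra.
  have -> : r / 2 = (`|t| + 2) * (r / (2 * (`|t| + 2))) by field; rewrite gt_eqF.
  by rewrite ler_wpM2l ?(ltW t2) // ge_min lexx orbT.
pose V0 := (delta / M') ^+ 2.
have dM0 : 0 < delta / M' by rewrite divr_gt0 //; lra.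
have V00 : 0 < V0 by rewrite exprn_gt0.
have sV0 : delta / Num.sqrt V0 = M'.
  rewrite sqrtr_sqr gtr0_norm //; field.
  by rewrite !gt_eqF //; lra.
have V0d : V0 <= delta.
  have h : delta / M' <= delta by rewrite ler_pdivrMr ?ler_peMr ?(ltW d0) //; lra.
  rewrite /V0 expr2 (le_trans _ h) // ler_piMl ?(ltW dM0) //; lra.
have [k1 k2] := hM M' MM'; rewrite -sV0 in k1 k2.
(* The limit law of the smoothed sum has variance [V0 + 1] instead of 1. *)
have close u : `|u - t| <= 2 * delta -> `|u / Num.sqrt (V0 + 1) - t| < r.
  move=> ut; set s := Num.sqrt _.
  have s1 : 1 <= s by rewrite -[leLHS]sqrtr1 ler_wsqrtr // lerDr ltW.
  have s0 : 0 < s by lra.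
  have ss : s ^+ 2 = V0 + 1 by rewrite sqr_sqrtr // addr_ge0 // ltW.
  have sV : s - 1 <= V0 by nra.
  apply: le_lt_trans dr.
  have -> : u / s - t = ((u - t) - t * (s - 1)) / s by field; rewrite gt_eqF.
  rewrite normrM normfV (gtr0_norm s0) ler_pdivrMr //.
  apply: (@le_trans _ _ ((`|t| + 2) * delta)); last first.
    by rewrite ler_peMr // mulr_ge0 ?(ltW t2) ?(ltW d0).
  rewrite (le_trans (ler_normB _ _)) // normrM (ger0_norm (_ : 0 <= s - 1)); last by lra.
  have : `|t| * (s - 1) <= `|t| * delta by rewrite ler_wpM2l // (le_trans sV).
  lra.
have [mu1 mu10 h1] := smoothed_clt Hmean Hvar indep ident (t + 2 * delta) V00 e4 sigma_gt0.
have [mu2 mu20 h2] := smoothed_clt Hmean Hvar indep ident (t - 2 * delta) V00 e4 sigma_gt0.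
have n1 := cmax mu1 mu10; have n2 := cmax mu2 mu20.
have /cvgrPdist_le /(_ _ e4) n3 := rem delta d0.
near=> n.
have mS := measurable_lin_comb eps (c n) n.
have mAn : measurable_fun setT (A n) by near: n.
have cn1 : sigma ^+ 2 * \sum_(j < n) c n j ^+ 2 = 1 by near: n.
have [up lo] := squeeze_cdf t mAn mS V00 d0 k1 k2.
have u1 : `|\int[P]_w smooth_cdf (t + 2 * delta) V0 (\sum_(j < n) c n j * eps j w)
      - smooth_cdf (t + 2 * delta) (V0 + 1) 0| <= e / 4.
  by apply: h1 => //; near: n.
have u2 : `|\int[P]_w smooth_cdf (t - 2 * delta) V0 (\sum_(j < n) c n j * eps j w)
      - smooth_cdf (t - 2 * delta) (V0 + 1) 0| <= e / 4.
  by apply: h2 => //; near: n.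
have u3 : fine (P [set w | delta < `|A n w - \sum_(j < n) c n j * eps j w|]) <= e / 4.
  have : `|0 - fine (P [set w | delta < `|A n w - \sum_(j < n) c n j * eps j w|])|
      <= e / 4 by near: n.
  by rewrite sub0r normrN; apply: le_trans; exact: ler_norm.
have w1 : `|smooth_cdf (t + 2 * delta) (V0 + 1) 0 - Phi t| <= e / 4.
  apply: hr; rewrite subr0; apply: close.
  by rewrite addrAC subrr add0r ger0_norm // mulr_ge0 // ltW.
have w2 : `|smooth_cdf (t - 2 * delta) (V0 + 1) 0 - Phi t| <= e / 4.
  apply: hr; rewrite subr0; apply: close.
  by rewrite addrAC subrr add0r normrN ger0_norm // mulr_ge0 // ltW.
move: u1 u2 w1 w2; rewrite !ler_norml.
move=> /andP[_ u1] /andP[u2 _] /andP[_ w1] /andP[w2 _].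
exact: budget up lo u3 u1 u2 w1 w2.
Unshelve. all: by end_near.
Qed.

End Slutsky.

(** * The estimator for large sample sizes *)

(** For an empty matrix the infimum is taken over the empty set, hence 0. *)
Lemma min_eigenvalue_gt0_size (R : realType) p (A : 'M[R]_p) :
  0 < min_eigenvalue A -> (0 < p)%N.
Proof.
case: p A => // A; rewrite /min_eigenvalue (_ : [set a | _] = set0) ?inf0 ?ltxx //.
rewrite -subset0 => a /eigenvalueP[v _].
by rewrite (_ : v = 0) ?eqxx //; apply/rowP => -[].
Qed.

Section Asymptotics.
Context (R : realType).
Variables (n0 : nat) (k m : nat -> nat).
Variables (X : forall n : nat, 'M[R]_(n, k n + m n)).
Variables (beta10 : forall n : nat, 'cV[R]_(k n)).
Variables (lambda : nat -> R) (gamma b0 b1 tau1 : R).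
Hypothesis HX : forall n, (n0 <= n)%N -> standardized (X n).
Hypothesis Hlambda : forall n, (n0 <= n)%N -> 0 <= lambda n.
Hypothesis Hgamma : 0 < gamma < 1.
Hypothesis Hrho : forall n, (n0 <= n)%N -> 0 < min_eigenvalue (gram (X n)).
Hypothesis Hrate : ((k n + m n)%:R + lambda n * (k n)%:R)
  * (n%:R * min_eigenvalue (gram (X n)))^-1 @[n --> \oo] --> (0 : R).
Hypothesis Hlambda_ub :
  lambda n * Num.sqrt ((k n)%:R / n%:R) @[n --> \oo] --> (0 : R).
Hypothesis Hlambda_lb :
  lambda n * n%:R `^ (- gamma / 2)
  * (min_eigenvalue (gram (X n)) / Num.sqrt (k n + m n)%:R)
      `^ (2 - gamma) @[n --> \oo] --> +oo.
Hypothesis Hb0 : 0 < b0.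
Hypothesis Hbeta10 : forall n, (n0 <= n)%N -> forall j : 'I_(k n),
  b0 <= `|beta10 n j 0| <= b1.
Hypothesis Htau : 0 < tau1.
Hypothesis Hlow : forall n, (n0 <= n)%N ->
  tau1 <= min_eigenvalue (gram (lsubmx (X n))).

Let rho n := min_eigenvalue (gram (X n)).
Let H n := Num.sqrt (k n + m n)%:R / (rho n * Num.sqrt n%:R).

Let k_gt0 n : (n0 <= n)%N -> (0 < k n)%N.
Proof. by move=> /Hlow /(lt_le_trans Htau) /min_eigenvalue_gt0_size. Qed.

Let H_gt0 n : (n0 <= n)%N -> (0 < n)%N -> 0 < H n.
Proof.
move=> hn n_gt0; rewrite divr_gt0 ?mulr_gt0 ?sqrtr_gt0 ?ltr0n ?Hrho //.
by rewrite addn_gt0 k_gt0.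
Qed.

(** The lower bound on [lambda] says exactly that [lambda] dominates
    [n * H `^ (2 - gamma)]. *)
Let signal_ratio n : (n0 <= n)%N -> (0 < n)%N ->
  lambda n * n%:R `^ (- gamma / 2) * (rho n / Num.sqrt (k n + m n)%:R) `^ (2 - gamma)
  = lambda n / (n%:R * H n `^ (2 - gamma)).
Proof.
move=> hn n_gt0; have Hn := H_gt0 hn n_gt0; have rn := Hrho hn.
have N0 : (0 : R) < n%:R by rewrite ltr0n.
have s0 : 0 < Num.sqrt n%:R :> R by rewrite sqrtr_gt0.
have p0 : 0 < Num.sqrt (k n + m n)%:R :> R.
  by rewrite sqrtr_gt0 ltr0n addn_gt0 k_gt0.
have -> : rho n / Num.sqrt (k n + m n)%:R = (Num.sqrt n%:R * H n)^-1.
  by rewrite /H; field; rewrite !gt_eqF.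
rewrite -mulrA; congr (_ * _).
have sH0 : 0 <= Num.sqrt n%:R * H n := mulr_ge0 (ltW s0) (ltW Hn).
rewrite -[(Num.sqrt n%:R * H n)^-1]powR_inv1 // -powRrM mulN1r.
rewrite powRM ?(ltW s0) ?(ltW Hn) // mulrA -powR12_sqrt ?(ltW N0) // -powRrM.
rewrite -powRD; last by rewrite (gt_eqF N0) implybT.
have -> : - gamma / 2 + 2^-1 * - (2 - gamma) = -1 :> R by field.
rewrite powR_inv1 ?(ltW N0) // powRN invfM //.
Qed.

(** The upper bound on [lambda], in the form in which it makes the bias of the
    penalty no larger than the noise. *)
Let lambda_sqrtn : \forall n \near \oo, lambda n * Num.sqrt (k n)%:R <= Num.sqrt n%:R.
Proof.
have /cvgrPdist_le /(_ 1 ltr01) := Hlambda_ub.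
apply: filterS2 (nbhs_infty_gt 0) => n n_gt0.
have s0 : 0 < Num.sqrt n%:R :> R by rewrite sqrtr_gt0 ltr0n.
rewrite sub0r normrN sqrtrM ?ler0n // sqrtrV ?ler0n // mulrA => h.
by rewrite -[leRHS]mul1r -ler_pdivrMr // (le_trans (ler_norm _)).
Qed.

(** The two bounds on [lambda] squeeze [n * H `^ (2 - gamma)] below [sqrt n], which
    forces the rate [H] to 0. *)
Let H_small eta : 0 < eta -> \forall n \near \oo, H n <= eta.
Proof.
move=> eta0; case/andP: Hgamma => g0 g1.
have e0 : 0 < eta `^ (2 - gamma) by rewrite powR_gt0.
have /cvgryPge /(_ 1) hlb := Hlambda_lb.
near=> n.
have n_gt0 : (0 < n)%N by near: n; exact: nbhs_infty_gt.
have hn : (n0 <= n)%N by near: n; exact: nbhs_infty_ge.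
have N0 : (0 : R) < n%:R by rewrite ltr0n.
have s0 : 0 < Num.sqrt n%:R :> R by rewrite sqrtr_gt0.
have Hn := H_gt0 hn n_gt0.
have h1 : 1 <= lambda n / (n%:R * H n `^ (2 - gamma)).
  by rewrite -signal_ratio //; near: n.
have h2 : lambda n * Num.sqrt (k n)%:R <= Num.sqrt n%:R by near: n.
have h3 : lambda n <= Num.sqrt n%:R.
  apply: le_trans h2; rewrite ler_peMr ?Hlambda // -[leLHS]sqrtr1 ler_wsqrtr //.
  by rewrite ler1n k_gt0.
have h4 : (eta `^ (2 - gamma))^-1 < Num.sqrt n%:R.
  rewrite -(gtr0_norm (_ : 0 < (eta `^ (2 - gamma))^-1)) ?invr_gt0 //.
  rewrite -sqrtr_sqr ltr_sqrt //.
  near: n; exact: nbhs_infty_gtr.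
have nH : 0 < n%:R * H n `^ (2 - gamma) by rewrite mulr_gt0 ?powR_gt0.
rewrite leNgt; apply/negP => etaH.
have h5 : eta `^ (2 - gamma) <= H n `^ (2 - gamma).
  by rewrite ge0_ler_powR ?nnegrE ?(ltW eta0) ?(ltW Hn) ?(ltW etaH) //; lra.
move: h1; rewrite ler_pdivlMr // mul1r leNgt => /negP; apply.
apply: (le_lt_trans h3).
apply: (@lt_le_trans _ _ (n%:R * eta `^ (2 - gamma))); last by rewrite ler_pM2l.
rewrite -{2}(sqr_sqrtr (ltW N0)) expr2 -mulrA ltr_pMr //.
by rewrite -ltr_pdivrMr // div1r.
Unshelve. all: by end_near.
Qed.

(** On the event that the noise correlates with the covariates no more than
    [M] times its standard size, everything holds deterministically for large
    sample sizes. *)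
Lemma eventually_oracle M delta : 0 <= M -> 0 < delta ->
  \forall n \near \oo, forall (e : nat -> R) (b : 'cV[R]_(k n + m n)),
    is_minimizer gamma (lambda n) (X n) (response (X n) (col_mx (beta10 n) 0) e) b ->
    dot ((X n)^T *m \col_(i < n) e i) ((X n)^T *m \col_(i < n) e i)
      <= M ^+ 2 * (n%:R * (k n + m n)%:R) ->
    dsubmx b = 0 /\
    forall v, v = Num.sqrt n%:R *: (usubmx b - beta10 n)
        - (Num.sqrt n%:R)^-1 *:
          (invmx (gram (lsubmx (X n))) *m ((lsubmx (X n))^T *m \col_(i < n) e i)) ->
      bilin v (gram (lsubmx (X n))) v <= delta.
Proof.
move=> M0 delta0; case/andP: (Hgamma) => g0 g1.
pose K := 2 * M + (b0 / 2) `^ (gamma - 1).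
pose C := K `^ (1 - gamma) * (2 * (M + K) + K).
pose D := (4 * tau1)^-1 * (b0 / 4) `^ (gamma - 1) ^+ 2.
have D0 : 0 < D.
  have hp : 0 < (b0 / 4) `^ (gamma - 1) by rewrite powR_gt0 // divr_gt0.
  by rewrite mulr_gt0 ?exprn_gt0 // invr_gt0 mulr_gt0.
pose B := 2 * b1 `^ gamma + 1.
have B0 : 0 < B by rewrite ltr_wpDl // mulr_ge0 ?powR_ge0.
have c20 : 0 < (b0 / 2) ^+ 2 / 2 by rewrite divr_gt0 ?exprn_gt0 ?divr_gt0.
have /cvgryPgt /(_ C) hlb := Hlambda_lb.
have /cvgrPdist_le /(_ ((b0 / 2) ^+ 2 / 2 / B)) hrate := Hrate.
have {}hrate := hrate (divr_gt0 c20 B0).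
have /cvgrPdist_le /(_ (Num.sqrt (delta / D))) hub := Hlambda_ub.
have {}hub : \forall n \near \oo,
    `|0 - lambda n * Num.sqrt ((k n)%:R / n%:R)| <= Num.sqrt (delta / D).
  by apply: hub; rewrite sqrtr_gt0 divr_gt0.
pose eta := b0 / 2 / (2 * (2 * M + 1)).
have M1 : 0 < 2 * M + 1 by rewrite ltr_wpDl // mulr_ge0.
have eta0 : 0 < eta by rewrite divr_gt0 ?divr_gt0 // mulr_gt0.
have hH := H_small eta0.
near=> n => e b bmin good.
have n_gt0 : (0 < n)%N by near: n; exact: nbhs_infty_gt.
have hn : (n0 <= n)%N by near: n; exact: nbhs_infty_ge.
have Hn := H_gt0 hn n_gt0.
have low j : b0 <= `|beta10 n j 0| by case/andP: (Hbeta10 hn j).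
have upp j : `|beta10 n j 0| <= b1 by case/andP: (Hbeta10 hn j).
have p_gt0 : (0 < k n + m n)%N by rewrite addn_gt0 k_gt0.
have N0 : (0 : R) < n%:R by rewrite ltr0n.
have lam : lambda n * Num.sqrt (k n)%:R <= Num.sqrt n%:R by near: n.
have close : dot (b - col_mx (beta10 n) 0) (b - col_mx (beta10 n) 0) <= (b0 / 2) ^+ 2.
  apply: le_trans (consistency_bound n_gt0 Hgamma (Hlambda hn) (Hrho hn) upp bmin M0 good) _.
  rewrite -/(rho n) -/(H n).
  have l1 : 4 * M ^+ 2 * H n ^+ 2 <= (b0 / 2) ^+ 2 / 2.
    have hh : H n <= eta by near: n.
    have : (2 * M + 1) * H n <= b0 / 2 / 2.
      apply: (@le_trans _ _ ((2 * M + 1) * eta)); first by rewrite ler_wpM2l ?(ltW M1).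
      by rewrite le_eqVlt; apply/orP; left; apply/eqP; rewrite /eta; field; rewrite gt_eqF.
    have MH : 0 <= M * H n by rewrite mulr_ge0 ?(ltW Hn).
    move: Hn; move: (H n) MH => h MH h0 hle.
    have h2 : 2 * (M * h) <= b0 / 4 by lra.
    have -> : 4 * M ^+ 2 * h ^+ 2 = (2 * (M * h)) ^+ 2 by ring.
    apply: (@le_trans _ _ ((b0 / 4) ^+ 2)).
      by rewrite lerXn2r ?nnegrE ?divr_ge0 ?(ltW Hb0) // mulr_ge0.
    have := sqr_ge0 b0; lra.
  have l2 : 2 * b1 `^ gamma * (lambda n * (k n)%:R / (n%:R * rho n)) <= (b0 / 2) ^+ 2 / 2.
    have r0 : 0 < n%:R * rho n by rewrite mulr_gt0 ?Hrho.
    have hr : lambda n * (k n)%:R / (n%:R * rho n) <= (b0 / 2) ^+ 2 / 2 / B.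
      have : `|0 - ((k n + m n)%:R + lambda n * (k n)%:R) * (n%:R * rho n)^-1|
          <= (b0 / 2) ^+ 2 / 2 / B by near: n.
      rewrite sub0r normrN; apply: le_trans; apply: le_trans _ (ler_norm _).
      by rewrite ler_wpM2r ?invr_ge0 ?(ltW r0) // lerDr ler0n.
    have lk0 : 0 <= lambda n * (k n)%:R / (n%:R * rho n).
      by rewrite mulr_ge0 ?invr_ge0 ?(ltW r0) // mulr_ge0 ?ler0n ?(Hlambda hn).
    apply: (@le_trans _ _ (B * (lambda n * (k n)%:R / (n%:R * rho n)))).
      by rewrite ler_wpM2r // /B lerDl.
    by rewrite mulrC -ler_pdivlMr.
  by rewrite [leRHS]splitr lerD.
have sparse : dsubmx b = 0.
  apply: (inactive_coefficients_zero n_gt0 Hgamma (Hlambda hn) (HX hn) (Hrho hn) Hb0 low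
    bmin M0 good close lam p_gt0).
  rewrite -/K -/C -/(rho n) -/(H n).
  have : C < lambda n * n%:R `^ (- gamma / 2)
      * (rho n / Num.sqrt (k n + m n)%:R) `^ (2 - gamma) by near: n.
  by rewrite signal_ratio // ltr_pdivlMr // mulr_gt0 ?powR_gt0.
split=> // v vdef.
apply: le_trans (remainder_bound n_gt0 Hgamma (Hlambda hn) Hb0 low
  bmin close sparse Htau (Hlow hn) vdef) _.
rewrite -/D -ler_pdivlMl // [leRHS]mulrC.
have hk : 0 <= (k n)%:R / n%:R :> R by rewrite divr_ge0 ?ler0n.
have : `|0 - lambda n * Num.sqrt ((k n)%:R / n%:R)| <= Num.sqrt (delta / D) by near: n.
rewrite sub0r normrN => h.
rewrite -(sqr_sqrtr hk) -exprMn -(sqr_sqrtr (_ : 0 <= delta / D)); last first.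
  by rewrite divr_ge0 ?ltW.
rewrite -(real_normK (num_real (_ * _))) lerXn2r ?nnegrE ?sqrtr_ge0 //.
Unshelve. all: by end_near.
Qed.

End Asymptotics.

(** * The score of the noise *)

Section Score.
Context (R : realType) (d : measure_display) (T : measurableType d).
Variable P : probability T R.

(** The limit theorem takes weights indexed by [nat], like the noise. *)
Definition extend_coef n (f : 'I_n -> R) (j : nat) : R := oapp f 0 (insub j).

Lemma extend_coefE n (f : 'I_n -> R) (i : 'I_n) : extend_coef f i = f i.
Proof. by rewrite /extend_coef valK. Qed.

Variables (eps : nat -> {RV P >-> R}) (sigma : R).
Hypothesis Hmean : forall i, 'E_P[eps i]%E = 0%E.
Hypothesis Hvar : forall i, 'V_P[eps i]%E = (sigma ^+ 2)%:E.
Hypothesis indep : independent_RVs eps.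

Definition score n p (X : 'M[R]_(n, p)) (w : T) : 'cV[R]_p :=
  X^T *m \col_(i < n) eps i w.

Lemma scoreE n p (X : 'M[R]_(n, p)) w j :
  score X w j 0 = \sum_(i < n) extend_coef (X ^~ j) i * eps i w.
Proof.
by rewrite mxE; apply: eq_bigr => i _; rewrite !mxE extend_coefE.
Qed.

Lemma measurable_score n p (X : 'M[R]_(n, p)) j :
  measurable_fun setT (fun w => score X w j 0).
Proof. by under eq_fun do rewrite scoreE; exact: measurable_lin_comb. Qed.

Lemma measurable_score_energy n p (X : 'M[R]_(n, p)) :
  measurable_fun setT (fun w => dot (score X w) (score X w)).
Proof.
under eq_fun do rewrite dotE.
by apply: measurable_sum => j; apply: measurable_funM; exact: measurable_score.
Qed.

(** Each coordinate of the score is a sum of independent centered variables whose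
    squared weights add up to [n] by standardization. *)
Lemma score_energy n p (X : 'M[R]_(n, p)) : (0 < n)%N -> standardized X ->
  (\int[P]_w (dot (score X w) (score X w))%:E
    = (sigma ^+ 2 * (n%:R * p%:R))%:E)%E.
Proof.
move=> n_gt0 sX.
have -> : (\int[P]_w (dot (score X w) (score X w))%:E
    = \int[P]_w \sum_(j < p) (score X w j 0 ^+ 2)%:E)%E.
  by apply: eq_integral => w _; rewrite dotE sumEFin.
rewrite ge0_integral_sum //; last 2 first.
- move=> j; apply/measurable_EFinP; apply: measurable_funX; exact: measurable_score.
- by move=> j w _; rewrite lee_fin sqr_ge0.
rewrite (eq_bigr (fun=> (sigma ^+ 2 * n%:R)%:E)) => [|j _].
  by rewrite sumEFin sumr_const card_ord -[_ *+ p]mulr_natr mulrA.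
under eq_integral do rewrite scoreE.
rewrite (lin_comb_second_moment Hmean Hvar indep); congr (_ * _)%:E.
under eq_bigr do rewrite extend_coefE.
have [_ /(congr1 ( *%R n%:R))] := sX j.
by rewrite mulVKf ?pnatr_eq0 -?lt0n // mulr1.
Qed.

Lemma score_tail n p (X : 'M[R]_(n, p)) (M : R) :
  (0 < n)%N -> (0 < p)%N -> standardized X -> 0 < M ->
  (P [set w | (M ^+ 2 * (n%:R * p%:R) < dot (score X w) (score X w))%R]
   <= (sigma ^+ 2 / M ^+ 2)%:E)%E.
Proof.
move=> n_gt0 p_gt0 sX M0.
set E := [set w | _].
have np0 : 0 < n%:R * p%:R :> R by rewrite mulr_gt0 ?ltr0n.
have a0 : 0 < M ^+ 2 * (n%:R * p%:R) by rewrite mulr_gt0 ?exprn_gt0.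
have mE : measurable E by apply: measurable_superlevel; exact: measurable_score_energy.
have hL : L1 P (fun w => dot (score X w) (score X w)).
  apply: L1_finite => [|w|]; [exact: measurable_score_energy|exact: dot_ge0|].
  by rewrite score_energy // ltry.
have : \int[P]_w (M ^+ 2 * (n%:R * p%:R) * \1_E w)
    <= \int[P]_w dot (score X w) (score X w).
  apply: le_Rintegral => //; first by apply: L1Z; exact: L1_indic.
  move=> w _; rewrite indicE; case: (boolP (w \in E)) => [|_].
    by rewrite inE mulr1 => /ltW.
  by rewrite mulr0 dot_ge0.
rewrite RintegralZl //; last exact: L1_indic.
rewrite Rintegral_indic // [leRHS]/Rintegral score_energy // => h.
rewrite -(fineK (fin_num_measure P _ mE)) lee_fin ler_pdivlMr ?exprn_gt0 //.
by rewrite -(ler_pM2r np0); move: h => /=; lra.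
Qed.

End Score.

(** * The linear term as a weighted sum of the noise *)

Section LinearTerm.
Context {R : realType}.
Variables (n k : nat) (W : 'M[R]_(n, k)) (sigma tau : R).
Hypotheses (n_gt0 : (0 < n)%N) (sigma_gt0 : 0 < sigma) (tau_gt0 : 0 < tau).
Hypothesis tauW : tau <= min_eigenvalue (gram W).

Let N0 : (0 : R) < n%:R. Proof. by rewrite ltr0n. Qed.
Let symS := gram_sym W.
Let uS := pd_unit symS tau_gt0 tauW.

Let sym_inv : (invmx (gram W))^T = invmx (gram W).
Proof. by rewrite trmx_inv symS. Qed.

Lemma linear_term_weightE (alpha : 'cV[R]_k) i :
  (alpha^T *m invmx (gram W) *m (row i W)^T) 0 0 = bilin (row i W)^T (invmx (gram W)) alpha.
Proof. exact: bilin_sym. Qed.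

Lemma sum_linear_term (alpha : 'cV[R]_k) (e : nat -> R) :
  \sum_(i < n) e i * (alpha^T *m invmx (gram W) *m (row i W)^T) 0 0
  = dot alpha (invmx (gram W) *m (W^T *m \col_(i < n) e i)).
Proof.
rewrite /dot !mulmxA [RHS]mxE; apply: eq_bigr => i _.
rewrite mulrC; congr (_ * _); last by rewrite mxE.
by rewrite [LHS]mxE [RHS]mxE; apply: eq_bigr => j _; rewrite !mxE.
Qed.

Lemma remainderE (alpha beta10 b1 : 'cV[R]_k) (e : nat -> R) :
  scaled_error sigma W alpha beta10 b1 - linear_term sigma W alpha e
  = (asymptotic_sd sigma (gram W) alpha)^-1 *
    dot alpha (Num.sqrt n%:R *: (b1 - beta10)
      - (Num.sqrt n%:R)^-1 *: (invmx (gram W) *m (W^T *m \col_(i < n) e i))).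
Proof.
rewrite /scaled_error /linear_term sum_linear_term -/(dot alpha _).
move: (b1 - beta10) (invmx _ *m _) => x y.
by rewrite -[- (_ *: y)]scaleNr dotDr !dotZr; ring.
Qed.

Variable alpha : 'cV[R]_k.
Hypothesis alpha0 : alpha != 0.

Definition clt_weight (i : 'I_n) : R :=
  (Num.sqrt n%:R)^-1 * (asymptotic_sd sigma (gram W) alpha)^-1
  * (alpha^T *m invmx (gram W) *m (row i W)^T) 0 0.

Let q := bilin alpha (invmx (gram W)) alpha.

Let q_gt0 : 0 < q.
Proof.
rewrite /q (pd_inv symS tau_gt0 tauW); apply: (pd_gt0 symS tau_gt0 tauW).
by apply: contra alpha0 => /eqP a0; rewrite -[alpha](mulKVmx uS) a0 mulmx0.
Qed.

Let sd2 : asymptotic_sd sigma (gram W) alpha ^+ 2 = sigma ^+ 2 * q.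
Proof. by rewrite sqr_sqrtr // mulr_ge0 ?sqr_ge0 ?(ltW q_gt0). Qed.

Let weight_sqr i : clt_weight i ^+ 2
  = (n%:R * (sigma ^+ 2 * q))^-1 * bilin (row i W)^T (invmx (gram W)) alpha ^+ 2.
Proof.
rewrite /clt_weight linear_term_weightE !exprMn !exprVn sqr_sqrtr ?(ltW N0) //.
by rewrite sd2 -invfM.
Qed.

(** The Gram matrix between its two inverses in the variance cancels one of
    them. *)
Lemma clt_weight_normalized : sigma ^+ 2 * \sum_i clt_weight i ^+ 2 = 1.
Proof.
under eq_bigr do rewrite weight_sqr.
rewrite -mulr_sumr.
have -> : \sum_i bilin (row i W)^T (invmx (gram W)) alpha ^+ 2 = n%:R * q.
  rewrite /q (pd_inv symS tau_gt0 tauW) bilin_gram mulVKf ?gt_eqF // dotE.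
  apply: eq_bigr => i _; rewrite -expr2; congr (_ ^+ 2).
  by rewrite bilin_dot /dot trmxK -row_mul [LHS]mxE.
by field; rewrite !gt_eqF.
Qed.

(** Cauchy-Schwarz for the inverse Gram form bounds each weight by the size of
    its covariate vector, uniformly in [alpha]. *)
Lemma clt_weight_bound i : clt_weight i ^+ 2
  <= (sigma ^+ 2 * tau)^-1 * (n%:R^-1 * \sum_(j < k) W i j ^+ 2).
Proof.
rewrite weight_sqr.
have inv_psd u : 0 <= bilin u (invmx (gram W)) u.
  by rewrite (pd_inv symS tau_gt0 tauW) (pd_ge0 symS tau_gt0 tauW).
have h1 := psd_cauchy_schwarz sym_inv inv_psd (row i W)^T alpha.
have h2 := pd_inv_upper symS tau_gt0 tauW (row i W)^T.
have rowE : dot (row i W)^T (row i W)^T = \sum_(j < k) W i j ^+ 2.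
  by rewrite dotE; apply: eq_bigr => j _; rewrite !mxE expr2.
rewrite rowE in h2.
have c0 : 0 <= (n%:R * (sigma ^+ 2 * q))^-1.
  by rewrite invr_ge0 mulr_ge0 ?(ltW N0) // mulr_ge0 ?sqr_ge0 ?(ltW q_gt0).
apply: le_trans (ler_wpM2l c0 h1) _; rewrite -/q.
apply: le_trans (ler_wpM2l c0 (ler_wpM2r (ltW q_gt0) h2)) _.
by rewrite le_eqVlt; apply/orP; left; apply/eqP; field; rewrite !gt_eqF.
Qed.

End LinearTerm.

(** * Negligible events *)

Section Events.
Context (R : realType) (d : measure_display) (T : measurableType d).
Variable P : probability T R.

(** The event [E n] does not depend on [M] although its bound does: [M] is chosen
    after the precision, and [n] after [M]. *)
Lemma negligible_events (E : nat -> set T) (bad : R -> nat -> set T) (C : R) :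
  0 <= C ->
  (\forall n \near \oo, measurable (E n)) ->
  (forall M, 0 < M -> \forall n \near \oo, measurable (bad M n)) ->
  (forall M, 0 < M -> \forall n \near \oo, (P (bad M n) <= (C / M ^+ 2)%:E)%E) ->
  (forall M, 0 < M -> \forall n \near \oo, E n `<=` bad M n) ->
  P (E n) @[n --> \oo] --> 0%E.
Proof.
move=> C0 mE mbad Pbad sub.
apply/fine_cvgP; split; first by apply: filterS mE => n mEn; exact: fin_num_measure.
apply/cvgrPdist_le => e e0.
pose M := 1 + C / e; have Ce : 0 <= C / e by rewrite divr_ge0 // ltW.
have M0 : 0 < M by rewrite ltr_pwDl.
have CM : C / M ^+ 2 <= e.
  rewrite ler_pdivrMr ?exprn_gt0 // mulrC -ler_pdivrMr //.
  by rewrite (le_trans (_ : C / e <= M)) ?lerDr // expr2 ler_peMl ?(ltW M0) // lerDl.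
near=> n.
have mEn : measurable (E n) by near: n.
have mbn : measurable (bad M n) by near: n; exact: mbad.
rewrite sub0r normrN ger0_norm ?fine_ge0 // (le_trans _ CM) //= -lee_fin.
rewrite fineK ?fin_num_measure //.
apply: (@le_trans _ _ (P (bad M n))); last by near: n; exact: Pbad.
by rewrite le_measure ?inE //; near: n; exact: sub.
Unshelve. all: by end_near.
Qed.

Lemma measurable_lin_form p (v : T -> 'cV[R]_p) (a : 'I_p -> R) :
  (forall j, measurable_fun setT (fun w => v w j 0)) ->
  measurable_fun setT (fun w => \sum_j a j * v w j 0).
Proof. by move=> mv; apply: measurable_sum => j; apply: measurable_funM. Qed.

Lemma measurable_dot p (a : 'cV[R]_p) (v : T -> 'cV[R]_p) :
  (forall j, measurable_fun setT (fun w => v w j 0)) ->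
  measurable_fun setT (fun w => dot a (v w)).
Proof.
move=> mv; under eq_fun do rewrite dotE.
exact: measurable_lin_form.
Qed.

Lemma measurable_mulmx p q (A : 'M[R]_(q, p)) (v : T -> 'cV[R]_p) j :
  (forall j, measurable_fun setT (fun w => v w j 0)) ->
  measurable_fun setT (fun w => (A *m v w) j 0).
Proof.
move=> mv; under eq_fun do rewrite mxE.
exact: measurable_lin_form.
Qed.

Lemma measurable_bilin p (A : 'M[R]_p) (v : T -> 'cV[R]_p) :
  (forall j, measurable_fun setT (fun w => v w j 0)) ->
  measurable_fun setT (fun w => bilin (v w) A (v w)).
Proof.
move=> mv; under eq_fun do rewrite bilin_dot dotE.
apply: measurable_sum => j; apply: measurable_funM => //.
exact: measurable_mulmx.
Qed.

End Events.

(** * Selection consistency and asymptotic normality *)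

Theorem theorem2
  (R : realType) (d : measure_display) (T : measurableType d)
  (P : probability T R)
  (* the model is given for the sample sizes n >= n0 *)
  (n0 : nat) (k m : nat -> nat)
  (X : forall n : nat, 'M[R]_(n, k n + m n))
  (beta10 : forall n : nat, 'cV[R]_(k n))
  (lambda : nat -> R) (gamma sigma : R)
  (eps : nat -> {RV P >-> R})
  (betahat : forall n : nat, T -> 'cV[R]_(k n + m n))
  (b0 b1 tau1 tau2 : R)
  (HX : forall n, (n0 <= n)%N -> standardized (X n))
  (Hlambda : forall n, (n0 <= n)%N -> 0 <= lambda n)
  (Hgamma : 0 < gamma < 1)
  (* the bridge estimator *)
  (Hmeas : forall n, (n0 <= n)%N -> forall j : 'I_(k n + m n),
     measurable_fun [set: T] (fun w => betahat n w j 0))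
  (Hmin : forall n, (n0 <= n)%N -> forall (w : T) (b : 'cV[R]_(k n + m n)),
     let Y := response (X n) (col_mx (beta10 n) 0) (fun i => eps i w) in
     bridge_objective gamma (lambda n) (X n) Y (betahat n w)
       <= bridge_objective gamma (lambda n) (X n) Y b)
  (* condition 1 *)
  (Hsigma : 0 < sigma)
  (Hindep : independent_RVs eps)
  (Hident : identically_distributed eps)
  (Hmean : forall i, 'E_P[eps i]%E = 0%E)
  (Hvar : forall i, 'V_P[eps i]%E = (sigma ^+ 2)%:E)
  (* condition 2 *)
  (Hrho : forall n, (n0 <= n)%N -> 0 < min_eigenvalue (gram (X n)))
  (Hrate : ((k n + m n)%:R + lambda n * (k n)%:R)
       * (n%:R * min_eigenvalue (gram (X n)))^-1 @[n --> \oo] --> (0 : R))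
  (* condition 3 *)
  (Hlambda_ub :
     lambda n * Num.sqrt ((k n)%:R / n%:R) @[n --> \oo] --> (0 : R))
  (Hlambda_lb :
     lambda n * n%:R `^ (- gamma / 2)
       * (min_eigenvalue (gram (X n)) / Num.sqrt (k n + m n)%:R)
           `^ (2 - gamma) @[n --> \oo] --> +oo)
  (* condition 4 *)
  (Hb : 0 < b0 < b1)
  (Hbeta10 : forall n, (n0 <= n)%N -> forall j : 'I_(k n),
     b0 <= `|beta10 n j 0| <= b1)
  (* condition 5 *)
  (Htau : 0 < tau1 < tau2)
  (Hlow : forall n, (n0 <= n)%N ->
     tau1 <= min_eigenvalue (gram (lsubmx (X n))))
  (Hmid : forall n, (n0 <= n)%N ->
     min_eigenvalue (gram (lsubmx (X n)))
       <= max_eigenvalue (gram (lsubmx (X n))))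
  (Hupp : forall n, (n0 <= n)%N ->
     max_eigenvalue (gram (lsubmx (X n))) <= tau2)
  (Hw : (Num.sqrt n%:R)^-1
       * \big[Num.max/0]_(i < n) \sum_(j < k n) lsubmx (X n) i j ^+ 2
       @[n --> \oo] --> (0 : R)) :
  (* (i) *)
  (P [set w | dsubmx (betahat n w) = 0] @[n --> \oo] --> 1%E)
  /\
  (* (ii): the remainder tends to 0 in probability uniformly in alpha, and
     the normalized error is asymptotically standard normal *)
  (forall delta : R, 0 < delta ->
     P [set w | exists alpha : 'cV[R]_(k n),
          [/\ alpha != 0, l2norm alpha <= 1 &
            delta < `|scaled_error sigma (lsubmx (X n)) alpha (beta10 n)
                        (usubmx (betahat n w))
                      - linear_term sigma (lsubmx (X n)) alpha
                          (fun i => eps i w)|] ]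
     @[n --> \oo] --> 0%E)
  /\
  (forall alpha : forall n : nat, 'cV[R]_(k n),
     (forall n, (n0 <= n)%N -> alpha n != 0 /\ l2norm (alpha n) <= 1) ->
     cvg_in_distribution P
       (fun n w => scaled_error sigma (lsubmx (X n)) (alpha n) (beta10 n)
                     (usubmx (betahat n w)))
       (normal_prob 0 1)).
Proof.
case/andP: (Hb) => b00 _; case/andP: (Htau) => tau10 _.
pose W n := lsubmx (X n).
pose S n := gram (W n).
(* The difference between the scaled error of the active coefficients and its
   linear approximation, before applying [alpha]. *)
pose v n w := Num.sqrt n%:R *: (usubmx (betahat n w) - beta10 n)
  - (Num.sqrt n%:R)^-1 *: (invmx (S n) *m ((W n)^T *m \col_(i < n) eps i w)).
(* Outside this event the estimator is controlled deterministically. *)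
pose bad M n := [set w | M ^+ 2 * (n%:R * (k n + m n)%:R)
  < dot (score eps (X n) w) (score eps (X n) w)].
have large : \forall n \near \oo, (n0 <= n)%N /\ (0 < n)%N.
  by near=> n; split; near: n; [exact: nbhs_infty_ge|exact: nbhs_infty_gt].
have k_gt0 n : (n0 <= n)%N -> (0 < k n)%N.
  by move=> /Hlow /(lt_le_trans tau10) /min_eigenvalue_gt0_size.
have mbad M : 0 < M -> \forall n \near \oo, measurable (bad M n).
  move=> _; apply: nearW => n; apply: measurable_superlevel.
  exact: measurable_score_energy.
have Pbad M : 0 < M -> \forall n \near \oo, (P (bad M n) <= (sigma ^+ 2 / M ^+ 2)%:E)%E.
  move=> M0; apply: filterS large => n [hn n_gt0].
  apply: (score_tail Hmean Hvar Hindep n_gt0 _ (HX n hn) M0).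
  by rewrite addn_gt0 k_gt0.
have oracle M delta : 0 < M -> 0 < delta -> \forall n \near \oo, forall w,
    ~ bad M n w -> dsubmx (betahat n w) = 0 /\ bilin (v n w) (S n) (v n w) <= delta.
  move=> M0 delta0.
  have := eventually_oracle HX Hlambda Hgamma Hrho Hrate Hlambda_ub Hlambda_lb b00
    Hbeta10 tau10 Hlow (ltW M0) delta0.
  apply: filterS2 large => n [hn n_gt0] h w nbad.
  have [|hd hv] := h (fun i => eps i w) (betahat n w) (Hmin n hn w).
    by rewrite leNgt; apply/negP.
  by split=> //; exact: hv.
have mv n j : (n0 <= n)%N -> measurable_fun setT (fun w => v n w j 0).
  move=> hn.
  have -> : (fun w => v n w j 0) = (fun w => Num.sqrt n%:R *
      (betahat n w (lshift (m n) j) 0 - beta10 n j 0)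
      - (Num.sqrt n%:R)^-1 * (invmx (S n) *m score eps (W n) w) j 0).
    by apply/funext => w; rewrite /v mxE; congr (_ + _); rewrite !mxE // mulrN.
  apply: measurable_funB; apply: measurable_funM => //.
    by apply: measurable_funB => //; exact: Hmeas.
  by apply: measurable_mulmx => i; exact: measurable_score.
have mq n : (n0 <= n)%N -> measurable_fun setT (fun w => bilin (v n w) (S n) (v n w)).
  by move=> hn; apply: measurable_bilin => j; exact: mv.
have mdelta n (delta : R) : (n0 <= n)%N ->
    measurable [set w | delta < bilin (v n w) (S n) (v n w)].
  by move=> hn; apply: measurable_superlevel; exact: mq.
have remainder_small delta : 0 < delta ->
    P [set w | (delta < bilin (v n w) (S n) (v n w))%R] @[n --> \oo] --> 0%E.
  move=> delta0; apply: (negligible_events (bad := bad) (sqr_ge0 sigma)) => //.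
    by apply: filterS large => n [hn _]; exact: mdelta.
  move=> M M0; apply: filterS (oracle M delta M0 delta0) => n h w hw.
  by apply: contrapT => /h[_]; rewrite leNgt hw.
split; [|split].
- have mz n : (n0 <= n)%N -> measurable [set w | dsubmx (betahat n w) = 0].
    move=> hn; have -> : [set w | dsubmx (betahat n w) = 0]
        = [set w | dot (dsubmx (betahat n w)) (dsubmx (betahat n w)) <= 0].
      apply/seteqP; split=> w /=; first by move=> ->; rewrite /dot mulmx0 mxE.
      by move=> h; apply/eqP; rewrite -dot_eq0 eq_le h dot_ge0.
    apply: measurable_sublevel; under eq_fun do rewrite dotE.
    apply: measurable_sum => j; under eq_fun do rewrite mxE.
    by apply: measurable_funM; exact: Hmeas.
  have neg : P (~` [set w | dsubmx (betahat n w) = 0]) @[n --> \oo] --> 0%E.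
    apply: (negligible_events (bad := bad) (sqr_ge0 sigma)) => //.
      by apply: filterS large => n [hn _]; apply: measurableC; exact: mz.
    move=> M M0; apply: filterS (oracle M 1 M0 ltr01) => n h w hw.
    by apply: contrapT => /h[].
  have -> : 1%E = (1 - 0)%E :> \bar R by rewrite sube0.
  apply: cvg_trans; last exact: (cvgeB _ (cvg_cst 1%E) neg).
  apply: near_eq_cvg; apply: filterS large => n [hn _].
  rewrite probability_setC; last exact: mz.
  rewrite -(fineK (fin_num_measure P _ (mz n hn))) -!EFinB.
  by congr EFin; ring.
- move=> delta delta0.
  have ds0 : 0 < (delta * sigma) ^+ 2 by rewrite exprn_gt0 // mulr_gt0.
  (* As a level set of a quadratic form, the event is measurable. *)
  apply: cvg_trans (remainder_small _ ds0).
  apply: near_eq_cvg; apply: filterS large => n [hn n_gt0].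
  congr (P _); apply/seteqP; split=> w /=.
    have h := exists_normalized_functional (gram_sym (W n)) tau10 (Hlow n hn) (v n w)
      Hsigma delta0.
    move=> /h [al [a0 a1 ha]]; exists al; split=> //.
    by rewrite remainderE.
  move=> [al [a0 a1]]; rewrite remainderE => ha.
  apply/(exists_normalized_functional (gram_sym (W n)) tau10 (Hlow n hn) (v n w)
      Hsigma delta0).
  by exists al.
move=> alpha Halpha t _.
pose c n := extend_coef (@clt_weight R n (k n) (W n) sigma (alpha n)).
pose A n w := scaled_error sigma (W n) (alpha n) (beta10 n) (usubmx (betahat n w)).
have SE n w : \sum_(j < n) c n j * eps j w
    = linear_term sigma (W n) (alpha n) (fun i => eps i w).
  rewrite /linear_term mulr_sumr; apply: eq_bigr => i _.
  by rewrite /c extend_coefE /clt_weight mulrAC mulrA.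
have mA n : (n0 <= n)%N -> measurable_fun setT (A n).
  move=> hn; apply: measurable_funM => //.
  rewrite -[X in measurable_fun _ X]/(fun w => dot (alpha n) (usubmx (betahat n w) - beta10 n)).
  apply: measurable_dot => j; under eq_fun do rewrite mxE.
  apply: measurable_funD; last by [].
  by under eq_fun do rewrite mxE; exact: Hmeas.
suff : (fun n => fine (P [set w | A n w <= t])) @ \oo --> Phi t.
  move=> h; have h2 : P [set w | (A n w <= t)%R] @[n --> \oo] --> (Phi t)%:E.
    apply/fine_cvgP; split=> //.
    apply: filterS large => n [hn _]; apply: fin_num_measure.
    exact/measurable_sublevel/mA.
  by rewrite Phi_normal_prob in h2; exact: h2.
apply: (clt_slutsky Hmean Hvar Hindep Hident Hsigma (c := c)).
- by apply: filterS large => n [hn _]; exact: mA.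
- apply: filterS large => n [hn n_gt0].
  under eq_bigr do rewrite /c extend_coefE.
  have [a0 _] := Halpha n hn.
  exact: (clt_weight_normalized n_gt0 Hsigma tau10 (Hlow n hn) a0).
- move=> mu mu0.
  have C0 : 0 < mu ^+ 2 * (sigma ^+ 2 * tau1).
    by rewrite mulr_gt0 ?exprn_gt0 // mulr_gt0 ?exprn_gt0.
  have /cvgrPdist_le /(_ _ C0) := Hw.
  apply: filterS2 large => n [hn n_gt0]; rewrite sub0r normrN => hmax j jn.
  have [a0 _] := Halpha n hn.
  have -> : c n j = clt_weight (W n) sigma (alpha n) (Ordinal jn).
    by rewrite /c -extend_coefE.
  have := clt_weight_bound n_gt0 Hsigma tau10 (Hlow n hn) a0 (Ordinal jn).
  set i := Ordinal jn => hi.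
  rewrite -(ger0_norm (ltW mu0)) -ler_sqr ?nnegrE // !real_normK ?num_real //.
  apply: le_trans hi _.
  have s0 : 0 < sigma ^+ 2 * tau1 by rewrite mulr_gt0 ?exprn_gt0.
  rewrite mulrC ler_pdivrMr //; apply: le_trans hmax; apply: le_trans (ler_norm _).
  apply: ler_pM; rewrite ?invr_ge0 ?ler0n //.
  - by apply: sumr_ge0 => l _; exact: sqr_ge0.
  - rewrite lef_pV2 ?posrE ?sqrtr_gt0 ?ltr0n //.
    rewrite -[leRHS](sqr_sqrtr (ler0n _ n)) expr2 ler_peMr ?sqrtr_ge0 //.
    by rewrite -[leLHS]sqrtr1 ler_wsqrtr // ler1n.
  - exact: (le_bigmax _ (fun i : 'I_n => \sum_(l < k n) lsubmx (X n) i l ^+ 2)).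
move=> delta delta0; apply: (@fine_cvg _ _ _ _ _ 0).
have ds0 : 0 < (delta * sigma) ^+ 2 by rewrite exprn_gt0 // mulr_gt0.
apply: (negligible_events (bad := bad) (sqr_ge0 sigma)) => //.
  apply: filterS large => n [hn _]; apply: measurable_superlevel.
  apply: measurableT_comp => //; apply: measurable_funB; first exact: mA.
  exact: measurable_lin_comb.
move=> M M0; apply: filterS2 large (oracle M _ M0 ds0) => n [hn n_gt0] h w /=.
have [a0 a1] := Halpha n hn.
rewrite SE remainderE => hw; apply: contrapT => /h[_]; rewrite leNgt => /negP; apply.
apply/(exists_normalized_functional (gram_sym (W n)) tau10 (Hlow n hn) (v n w)
      Hsigma delta0).
by exists (alpha n).
Unshelve. all: by end_near.
Qed.
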